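(* Let $n\ge2$ and $\beta_0<\beta_2<\beta_1$. The shape process $H^k$ is ergodic for every $2\le k\le n+2$ if either (a) $\beta_2>n\beta_0$, or (b) $\beta_2>\frac{(n-1)\beta_1+\beta_0}{n}$. Moreover, if (c) $\beta_2>4\sqrt2\sqrt{\beta_1\beta_0}$, then $H^k$ is ergodic for every $k\ge2$.
   Context: For $k\ge2$ and $\beta=(\beta_0,\beta_1,\beta_2)\in(0,\infty)^3$: for $x\in\mathbb{N}^k$, with zero boundary convention $x(0)=x(k+1)=0$, let $V_j(x)=\mathbf 1_{\{x(j-1)>x(j)\}}+\mathbf 1_{\{x(j+1)>x(j)\}}$. The crystal process $X^k$ is the continuous-time Markov chain on $\mathbb{N}^k$ jumping from $x$ to $x+e_j$ at rate $\beta_{V_j(x)}$, no other transitions; its shape process is $H^k_t=(X^k_t(1)-X^k_t(2),\dots,X^k_t(k-1)-X^k_t(k))\in\mathbb{Z}^{k-1}$, a Markov chain; ergodic means positive recurrent. *)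

(* Defs.v *)
From Stdlib Require Import Reals ZArith Arith List Bool.
Import ListNotations.
Open Scope R_scope.

(* A shape h in Z^(k-1) is represented by h : nat -> Z, only the entries
   h 1, ..., h (k-1) being meaningful; h i = x(i) - x(i+1). *)
Definition shape := nat -> Z.

(* V_j(x) = 1{x(j-1) > x(j)} + 1{x(j+1) > x(j)} with x(0) = x(k+1) = 0,
   expressed in terms of the shape: for j >= 2, x(j-1) > x(j) iff h(j-1) > 0;
   for j <= k-1, x(j+1) > x(j) iff h(j) < 0; the boundary indicators vanish
   because x >= 0. *)
Definition Vj (k : nat) (h : shape) (j : nat) : nat :=
  ((if (2 <=? j)%nat && (0 <? h (j - 1)%nat)%Z then 1 else 0)
   + (if (j <=? k - 1)%nat && (h j <? 0)%Z then 1 else 0))%nat.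

Definition beta_of (b0 b1 b2 : R) (v : nat) : R :=
  match v with 0%nat => b0 | 1%nat => b1 | _ => b2 end.

Definition rate (k : nat) (b0 b1 b2 : R) (h : shape) (j : nat) : R :=
  beta_of b0 b1 b2 (Vj k h j).

Definition qtot (k : nat) (b0 b1 b2 : R) (h : shape) : R :=
  fold_right Rplus 0 (map (rate k b0 b1 b2 h) (seq 1 k)).

(* effect of x -> x + e_j on the shape: h(j) += 1, h(j-1) -= 1 *)
Definition jump (h : shape) (j : nat) : shape :=
  fun i => (h i + (if (i =? j)%nat then 1 else 0)
               - (if (2 <=? j)%nat && (i =? j - 1)%nat then 1 else 0))%Z.

Definition same_shape (k : nat) (h h' : shape) : bool :=
  forallb (fun i => Z.eqb (h i) (h' i)) (seq 1 (k - 1)).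

Fixpoint paths (k n : nat) : list (list nat) :=
  match n with
  | O => [[]]
  | S n' => flat_map (fun j => map (cons j) (paths k n')) (seq 1 k)
  end.

Fixpoint path_prob (k : nat) (b0 b1 b2 : R) (h : shape) (p : list nat) : R :=
  match p with
  | [] => 1
  | j :: p' => rate k b0 b1 b2 h j / qtot k b0 b1 b2 h
               * path_prob k b0 b1 b2 (jump h j) p'
  end.

(* expected total holding time along a jump path (sum of mean holding
   times 1/q at the states visited before each jump) *)
Fixpoint path_time (k : nat) (b0 b1 b2 : R) (h : shape) (p : list nat) : R :=
  match p with
  | [] => 0
  | j :: p' => / qtot k b0 b1 b2 h + path_time k b0 b1 b2 (jump h j) p'
  end.

Fixpoint path_end (h : shape) (p : list nat) : shape :=
  match p with [] => h | j :: p' => path_end (jump h j) p' end.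

Fixpoint avoids (k : nat) (s h : shape) (p : list nat) : bool :=
  match p with
  | [] => true
  | [_] => true
  | j :: p' => negb (same_shape k (jump h j) s) && avoids k s (jump h j) p'
  end.

Definition first_return (k : nat) (s : shape) (p : list nat) : bool :=
  avoids k s s p && same_shape k (path_end s p) s.

Definition ret_prob_term (k : nat) (b0 b1 b2 : R) (s : shape) (n : nat) : R :=
  fold_right Rplus 0
    (map (fun p => if first_return k s p then path_prob k b0 b1 b2 s p else 0)
         (paths k (S n))).

Definition ret_time_term (k : nat) (b0 b1 b2 : R) (s : shape) (n : nat) : R :=
  fold_right Rplus 0
    (map (fun p => if first_return k s p
                   then path_prob k b0 b1 b2 s p * path_time k b0 b1 b2 s p
                   else 0)
         (paths k (S n))).

Definition pos_recurrent_state (k : nat) (b0 b1 b2 : R) (s : shape) : Prop :=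
  infinite_sum (ret_prob_term k b0 b1 b2 s) 1 /\
  exists m : R, infinite_sum (ret_time_term k b0 b1 b2 s) m.

Definition shape_ergodic (k : nat) (b0 b1 b2 : R) : Prop :=
  forall s : shape, pos_recurrent_state k b0 b1 b2 s.

(* Main.v *)
Require Import Defs.
From Stdlib Require Import Reals ZArith Arith List Bool Lia Lra.
Import ListNotations.
Open Scope R_scope.

(** An interval of m sites standing above its neighbours rises with mean speed
    less than beta_2, whereas the higher of its neighbours rises at rate at least
    beta_2 as long as it is below the adjacent site of the interval: hence no
    interval can run away from its neighbours.  Quantitatively, give site j the
    weight y_j = exp (theta x_j) (0 outside 1..k), and for every interval
    J = {l, ..., l+m-1} other than {1, ..., k} consider Q_J = Phi_J / Y_J, where
    Y_J is the larger of the weights of the two neighbours of J and Phi_J is a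
    potential of degree 1 in the weights of J.  If the generator L satisfies
    L Phi_J <= lambda Phi_J + C Y_J with lambda < (1 - exp (- theta)) beta_2, then
    L Q_J <= - delta Q_J + C when the higher neighbour is below the adjacent site;
    otherwise that site can be removed from J at the cost of a constant factor, so
    L Q_J <= - delta Q_J + C' (1 + Q_J'), with J' shorter.  A combination of the
    Q_J with weights decreasing geometrically in the length of J is then a
    Lyapunov function.

    Under (a), Phi_J is, for m <= k - 2, the maximum of the weights (only maxima of
    J contribute, at rate beta_0 each); under (b) it is their geometric mean (at
    least one of the m sites has rate beta_0, the others at most beta_1).  Under
    (c), with exp theta = 2, Phi_J is the sum of the weights plus a multiple of
    their total variation: lateral growth at rate beta_1 does not increase the
    variation and increases the sum by at most the variation, while growth of local
    maxima has the small rate beta_0. *)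

(** * Finite sums and the jump chain *)

Definition Rsum {A : Type} (f : A -> R) (l : list A) : R :=
  fold_right Rplus 0 (map f l).

Lemma Rsum_cons {A} (f : A -> R) x l : Rsum f (x :: l) = f x + Rsum f l.
Proof. reflexivity. Qed.

Lemma Rsum_app {A} (f : A -> R) l l' : Rsum f (l ++ l') = Rsum f l + Rsum f l'.
Proof.
  induction l as [|x l IH]; simpl; [unfold Rsum; simpl; lra|].
  rewrite !Rsum_cons, IH; lra.
Qed.

Lemma Rsum_ext_in {A} (f g : A -> R) l :
  (forall x, In x l -> f x = g x) -> Rsum f l = Rsum g l.
Proof. intros H; unfold Rsum; f_equal; apply map_ext_in, H. Qed.

Lemma Rsum_le {A} (f g : A -> R) l :
  (forall x, In x l -> f x <= g x) -> Rsum f l <= Rsum g l.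
Proof.
  induction l as [|x l IH]; intros H; [apply Rle_refl|].
  rewrite !Rsum_cons; apply Rplus_le_compat; [apply H; now left|].
  apply IH; intros y Hy; apply H; now right.
Qed.

Lemma Rsum_plus {A} (f g : A -> R) l :
  Rsum (fun x => f x + g x) l = Rsum f l + Rsum g l.
Proof.
  induction l as [|x l IH]; [unfold Rsum; simpl; lra|].
  rewrite !Rsum_cons, IH; lra.
Qed.

Lemma Rsum_scal {A} (c : R) (f : A -> R) l :
  Rsum (fun x => c * f x) l = c * Rsum f l.
Proof.
  induction l as [|x l IH]; [unfold Rsum; simpl; lra|].
  rewrite !Rsum_cons, IH; lra.
Qed.

Lemma Rsum_zero {A} (f : A -> R) l : (forall x, In x l -> f x = 0) -> Rsum f l = 0.
Proof.
  induction l as [|x l IH]; intros H; [reflexivity|].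
  rewrite Rsum_cons, H, IH; [lra| |now left].
  intros y Hy; apply H; now right.
Qed.

Lemma Rsum_nonneg {A} (f : A -> R) l :
  (forall x, In x l -> 0 <= f x) -> 0 <= Rsum f l.
Proof.
  intros H; rewrite <- (Rsum_zero (fun _ => 0) l) by auto; now apply Rsum_le.
Qed.

Lemma Rsum_const {A} (c : R) (l : list A) : Rsum (fun _ => c) l = INR (length l) * c.
Proof.
  induction l as [|x l IH]; [unfold Rsum; simpl; lra|].
  rewrite Rsum_cons, IH; simpl length; rewrite S_INR; lra.
Qed.

Lemma Rsum_flat_map {A B} (f : B -> R) (g : A -> list B) l :
  Rsum f (flat_map g l) = Rsum (fun x => Rsum f (g x)) l.
Proof.
  induction l as [|x l IH]; [reflexivity|].
  simpl flat_map; rewrite Rsum_app, IH; reflexivity.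
Qed.

Lemma Rsum_map {A B} (f : B -> R) (g : A -> B) l :
  Rsum f (map g l) = Rsum (fun x => f (g x)) l.
Proof. unfold Rsum; now rewrite map_map. Qed.

Lemma Rsum_ge_term {A} (f : A -> R) l x :
  (forall y, In y l -> 0 <= f y) -> In x l -> f x <= Rsum f l.
Proof.
  induction l as [|z l IH]; intros Hf [].
  - subst; rewrite Rsum_cons.
    assert (0 <= Rsum f l) by (apply Rsum_nonneg; intros; apply Hf; now right); lra.
  - rewrite Rsum_cons.
    assert (0 <= f z) by (apply Hf; now left).
    assert (f x <= Rsum f l) by (apply IH; auto; intros; apply Hf; now right); lra.
Qed.

Lemma Rsum_single {A} (f : A -> R) l x :
  NoDup l -> In x l -> (forall y, In y l -> y <> x -> f y = 0) -> Rsum f l = f x.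
Proof.
  induction l as [|z l IH]; intros Hd [] Hz.
  - subst; rewrite Rsum_cons, Rsum_zero; [lra|].
    inversion Hd; subst; intros y Hy; apply Hz; [now right|congruence].
  - inversion Hd; subst; rewrite Rsum_cons, Hz, IH; auto; [lra| |now left|congruence].
    intros y Hy; apply Hz; now right.
Qed.

(** * Survival probabilities of the embedded jump chain *)

Section Chain.

Variables (k : nat) (b0 b1 b2 : R).
Hypotheses (hk : (1 <= k)%nat) (h0 : 0 < b0) (h02 : b0 < b2) (h21 : b2 < b1).

Lemma beta_of_bounds v : b0 <= beta_of b0 b1 b2 v <= b1.
Proof. destruct v as [|[|v]]; simpl; lra. Qed.

Lemma qtot_bounds h : b0 <= qtot k b0 b1 b2 h <= INR k * b1.
Proof.
  change (qtot k b0 b1 b2 h) with (Rsum (rate k b0 b1 b2 h) (seq 1 k)); split.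
  - apply Rle_trans with (rate k b0 b1 b2 h 1); [apply beta_of_bounds|].
    apply Rsum_ge_term; [|apply in_seq; lia].
    intros j _; unfold rate; destruct (beta_of_bounds (Vj k h j)); lra.
  - replace (INR k * b1) with (Rsum (fun _ => b1) (seq 1 k))
      by now rewrite Rsum_const, length_seq.
    apply Rsum_le; intros j _; apply beta_of_bounds.
Qed.

Definition jprob (h : shape) (j : nat) : R := rate k b0 b1 b2 h j / qtot k b0 b1 b2 h.

Definition jprob_min : R := b0 / (INR k * b1).

Lemma k_b1_pos : 0 < INR k * b1.
Proof. destruct (qtot_bounds (fun _ => 0%Z)); lra. Qed.

Lemma jprob_min_pos : 0 < jprob_min.
Proof. apply Rdiv_lt_0_compat; [lra|apply k_b1_pos]. Qed.

Lemma jprob_ge h j : jprob_min <= jprob h j.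
Proof.
  destruct (qtot_bounds h) as [Hq Hq'], (beta_of_bounds (Vj k h j)) as [Hr _].
  unfold jprob, jprob_min, Rdiv, rate.
  apply Rmult_le_compat; try lra.
  - apply Rlt_le, Rinv_0_lt_compat, k_b1_pos.
  - apply Rinv_le_contravar; lra.
Qed.

Lemma jprob_pos h j : 0 < jprob h j.
Proof. generalize (jprob_ge h j) jprob_min_pos; lra. Qed.

Lemma jprob_total h : Rsum (jprob h) (seq 1 k) = 1.
Proof.
  unfold jprob, Rdiv.
  rewrite (Rsum_ext_in _ (fun j => / qtot k b0 b1 b2 h * rate k b0 b1 b2 h j))
    by (intros; apply Rmult_comm).
  rewrite Rsum_scal.
  change (Rsum (rate k b0 b1 b2 h) (seq 1 k)) with (qtot k b0 b1 b2 h).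
  apply Rinv_l; generalize (qtot_bounds h); lra.
Qed.

Section Target.

Variable s : shape.

(* Survival up to time [n]; being at [s] at time 0 does not count as a visit. *)
Fixpoint surv (n : nat) (h : shape) : R :=
  match n with
  | O => 1
  | S n' => Rsum (fun j => jprob h j *
                     (if same_shape k (jump h j) s then 0 else surv n' (jump h j)))
                 (seq 1 k)
  end.

Lemma surv_nonneg n h : 0 <= surv n h.
Proof.
  revert h; induction n as [|n IH]; intros h; simpl; [lra|].
  apply Rsum_nonneg; intros j _; apply Rmult_le_pos; [apply Rlt_le, jprob_pos|].
  destruct same_shape; [lra|apply IH].
Qed.

Lemma surv_S_le n h : surv (S n) h <= surv n h.
Proof.
  revert h; induction n as [|n IH]; intros h.
  - rewrite <- (jprob_total h) at 1; simpl surv.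
    apply Rle_trans with (Rsum (jprob h) (seq 1 k)).
    + apply Rsum_le; intros j _; generalize (jprob_pos h j).
      destruct same_shape; lra.
    + rewrite jprob_total; lra.
  - change (surv (S n) h) with
      (Rsum (fun j => jprob h j *
               (if same_shape k (jump h j) s then 0 else surv n (jump h j))) (seq 1 k)).
    change (surv (S (S n)) h) with
      (Rsum (fun j => jprob h j *
               (if same_shape k (jump h j) s then 0 else surv (S n) (jump h j))) (seq 1 k)).
    apply Rsum_le; intros j _; apply Rmult_le_compat_l; [apply Rlt_le, jprob_pos|].
    destruct same_shape; [lra|apply IH].
Qed.

Lemma surv_antitone n m h : (n <= m)%nat -> surv m h <= surv n h.
Proof.
  induction 1 as [|m _ IH]; [lra|]; generalize (surv_S_le m h); lra.
Qed.

Lemma surv_le_1 n h : surv n h <= 1.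
Proof. apply (surv_antitone 0); lia. Qed.

(** Following the word [p] has probability at least [jprob_min ^ length p], and it forces a visit to
    [s] no later than its last jump. *)
Lemma surv_path p h :
  p <> [] -> (forall j, In j p -> (1 <= j <= k)%nat) ->
  same_shape k (path_end h p) s = true ->
  surv (length p) h <= 1 - jprob_min ^ length p.
Proof.
  revert h; induction p as [|j p IH]; intros h Hne Hp Hs; [congruence|].
  assert (Hj : In j (seq 1 k)) by (apply in_seq; specialize (Hp j (or_introl eq_refl)); lia).
  set (g := fun i => if same_shape k (jump h i) s then 0 else surv (length p) (jump h i)).
  assert (Hg : forall i, 0 <= g i <= 1).
  { intros i; unfold g; destruct (same_shape k (jump h i) s); [split; lra|].
    split; [apply surv_nonneg|apply surv_le_1]. }
  assert (Hgj : g j <= 1 - jprob_min ^ length p).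
  { unfold g; destruct (same_shape k (jump h j) s) eqn:E.
    (* The first jump already visits [s]: the survival is 0 and only [jprob_min <= 1] is needed. *)
    - assert (jprob_min ^ length p <= 1); [|lra].
      rewrite <- (pow1 (length p)); apply pow_incr; split; [apply Rlt_le, jprob_min_pos|].
      apply Rle_trans with (jprob h j); [apply jprob_ge|].
      rewrite <- (jprob_total h); apply Rsum_ge_term; auto.
      intros i _; apply Rlt_le, jprob_pos.
    - destruct p as [|i p]; [change (same_shape k (jump h j) s = true) in Hs; congruence|].
      apply IH; [discriminate| |exact Hs].
      intros i' Hi'; apply Hp; now right. }
  change (surv (length (j :: p)) h) with (Rsum (fun i => jprob h i * g i) (seq 1 k)).
  assert (H : jprob h j * (1 - g j) <= Rsum (fun i => jprob h i * (1 - g i)) (seq 1 k)).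
  { apply (Rsum_ge_term (fun i => jprob h i * (1 - g i))); auto.
    intros i _; apply Rmult_le_pos; [apply Rlt_le, jprob_pos|]; specialize (Hg i); lra. }
  assert (E : Rsum (fun i => jprob h i * (1 - g i)) (seq 1 k) =
              1 - Rsum (fun i => jprob h i * g i) (seq 1 k)).
  { rewrite <- (jprob_total h) at 1.
    rewrite (Rsum_ext_in _ (fun i => jprob h i + (-1) * (jprob h i * g i)))
      by (intros; ring).
    rewrite Rsum_plus, Rsum_scal; lra. }
  rewrite E in H; simpl.
  assert (jprob_min * jprob_min ^ length p <= jprob h j * (1 - g j)); [|lra].
  apply Rmult_le_compat; try lra; [apply Rlt_le, jprob_min_pos| |apply jprob_ge].
  apply pow_le, Rlt_le, jprob_min_pos.
Qed.

(** Extends [first_return] to an arbitrary start [h], because the recursion on the first jump leaves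
    [s]. *)
Definition hit (h : shape) (p : list nat) : bool :=
  avoids k s h p && same_shape k (path_end h p) s.

Lemma paths_length n p : In p (paths k n) -> length p = n.
Proof.
  revert p; induction n as [|n IH]; simpl; intros p Hp; [destruct Hp as [<-|[]]; auto|].
  apply in_flat_map in Hp; destruct Hp as [j [_ Hp]].
  apply in_map_iff in Hp; destruct Hp as [q [<- Hq]]; simpl; f_equal; auto.
Qed.

Lemma Rsum_paths_S f n :
  Rsum f (paths k (S n)) =
  Rsum (fun j => Rsum (fun p => f (j :: p)) (paths k n)) (seq 1 k).
Proof.
  simpl paths; rewrite Rsum_flat_map; apply Rsum_ext_in; intros j _; apply Rsum_map.
Qed.

(** Decomposition by the first jump gives both sides the same recursion: a first visit exactly at
    jump [S n] means surviving [n] jumps but not the next one. *)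
Lemma hit_prob n h :
  Rsum (fun p => if hit h p then path_prob k b0 b1 b2 h p else 0) (paths k (S n)) =
  surv n h - surv (S n) h.
Proof.
  revert h; induction n as [|n IH]; intros h.
  - rewrite Rsum_paths_S.
    change (surv 0 h) with 1; rewrite <- (jprob_total h).
    assert (E : forall a b, a + b = Rsum (jprob h) (seq 1 k) ->
                a = Rsum (jprob h) (seq 1 k) - b) by (intros; lra).
    apply E; simpl surv; rewrite <- Rsum_plus; apply Rsum_ext_in; intros j _.
    unfold Rsum, hit; simpl; fold (jprob h j); destruct same_shape; lra.
  - rewrite Rsum_paths_S.
    change (surv (S n) h) with
      (Rsum (fun j => jprob h j *
               (if same_shape k (jump h j) s then 0 else surv n (jump h j))) (seq 1 k)).
    change (surv (S (S n)) h) with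
      (Rsum (fun j => jprob h j *
               (if same_shape k (jump h j) s then 0 else surv (S n) (jump h j))) (seq 1 k)).
    assert (E : forall a b c, a + c = b -> a = b - c) by (intros; lra).
    apply E; rewrite <- Rsum_plus; apply Rsum_ext_in; intros j _.
    rewrite (Rsum_ext_in _ (fun p => jprob h j *
       (if same_shape k (jump h j) s then 0
        else if hit (jump h j) p then path_prob k b0 b1 b2 (jump h j) p else 0))).
    + rewrite Rsum_scal; destruct same_shape.
      * rewrite Rsum_zero by auto; lra.
      * rewrite IH; lra.
    (* The remaining word is nonempty, so the state after jump [j] is not the final one and [avoids]
       does test it. *)
    + intros p Hp; apply paths_length in Hp; destruct p as [|i p]; [discriminate|].
      unfold hit.
      change (avoids k s h (j :: i :: p)) with
        (negb (same_shape k (jump h j) s) && avoids k s (jump h j) (i :: p)).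
      change (path_end h (j :: i :: p)) with (path_end (jump h j) (i :: p)).
      change (path_prob k b0 b1 b2 h (j :: i :: p)) with
        (jprob h j * path_prob k b0 b1 b2 (jump h j) (i :: p)).
      destruct (same_shape k (jump h j) s); simpl negb; [simpl; lra|].
      rewrite andb_true_l; destruct (_ && _); lra.
Qed.

Lemma path_prob_nonneg p h : 0 <= path_prob k b0 b1 b2 h p.
Proof.
  revert h; induction p as [|j p IH]; intros h; simpl; [lra|].
  apply Rmult_le_pos; [apply Rlt_le, jprob_pos|apply IH].
Qed.

Lemma path_time_bounds p h :
  0 <= path_time k b0 b1 b2 h p <= INR (length p) * / b0.
Proof.
  revert h; induction p as [|j p IH]; intros h; simpl length; [simpl; lra|].
  rewrite S_INR; simpl; specialize (IH (jump h j)); generalize (qtot_bounds h); intros Hq.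
  assert (0 < / qtot k b0 b1 b2 h) by (apply Rinv_0_lt_compat; lra).
  assert (/ qtot k b0 b1 b2 h <= / b0) by (apply Rinv_le_contravar; lra).
  lra.
Qed.

(** The return probabilities telescope to [1 - surv], and the mean number of jumps before the return
    is the sum of the survival probabilities; each holding time has mean at most [/ b0]. *)
Lemma pos_recurrent_of_surv_summable W :
  (forall n, sum_f_R0 (fun i => surv i s) n <= W) -> pos_recurrent_state k b0 b1 b2 s.
Proof.
  intros HW.
  assert (Hret : forall n, ret_prob_term k b0 b1 b2 s n = surv n s - surv (S n) s)
    by (intros n; rewrite <- hit_prob; reflexivity).
  split.
  - assert (Hsum : forall n, sum_f_R0 (ret_prob_term k b0 b1 b2 s) n = 1 - surv (S n) s).
    { induction n as [|n IHn].
      - simpl sum_f_R0; rewrite Hret; reflexivity.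
      - simpl sum_f_R0; rewrite IHn, Hret; ring. }
    (* Survival is nonincreasing, so a bounded sum forces it to decay like [W / n]. *)
    assert (Hlow : forall n, INR (S n) * surv n s <= W).
    { intros n; apply Rle_trans with (2 := HW n).
      rewrite Rmult_comm, <- sum_cte; apply sum_Rle; intros i Hi; now apply surv_antitone. }
    intros eps Heps.
    assert (HW0 : 0 <= W) by (generalize (HW 0%nat) (surv_nonneg 0 s); simpl; lra).
    destruct (archimed (W / eps)) as [Ha _].
    exists (Z.to_nat (up (W / eps))); intros n Hn; unfold Rdist; rewrite Hsum.
    replace (1 - surv (S n) s - 1) with (- surv (S n) s) by ring.
    rewrite Rabs_Ropp, Rabs_pos_eq by apply surv_nonneg.
    specialize (Hlow (S n)).
    assert (Hn' : W / eps < INR (S (S n))).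
    { apply Rlt_le_trans with (1 := Ha); rewrite INR_IZR_INZ; apply IZR_le; lia. }
    assert (Hm : W < INR (S (S n)) * eps).
    { apply Rmult_lt_compat_r with (r := eps) in Hn'; [|lra].
      unfold Rdiv in Hn'; rewrite Rmult_assoc, Rinv_l in Hn'; lra. }
    apply Rmult_lt_reg_l with (INR (S (S n))); [apply lt_0_INR; lia|lra].
  - assert (Ht : forall n, 0 <= ret_time_term k b0 b1 b2 s n
                 <= / b0 * (INR (S n) * (surv n s - surv (S n) s))).
    { intros n.
      replace (/ b0 * (INR (S n) * (surv n s - surv (S n) s))) with
        (INR (S n) * / b0 * (surv n s - surv (S n) s)) by ring.
      rewrite <- hit_prob, <- Rsum_scal.
      change (ret_time_term k b0 b1 b2 s n) with
        (Rsum (fun p => if hit s p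
                 then path_prob k b0 b1 b2 s p * path_time k b0 b1 b2 s p
                 else 0) (paths k (S n))).
      split.
      - apply Rsum_nonneg; intros p _; destruct hit; [|lra].
        apply Rmult_le_pos; [apply path_prob_nonneg|apply path_time_bounds].
      - apply Rsum_le; intros p Hp; destruct hit; [|lra].
        rewrite Rmult_comm; apply Rmult_le_compat_r; [apply path_prob_nonneg|].
        apply paths_length in Hp; rewrite <- Hp; apply path_time_bounds. }
    (* Summation by parts turns the mean return time into a sum of tails. *)
    assert (Habel : forall n, sum_f_R0 (fun i => INR (S i) * (surv i s - surv (S i) s)) n
                    = sum_f_R0 (fun i => surv i s) n - INR (S n) * surv (S n) s).
    { induction n as [|n IHn]; [simpl; ring|].
      rewrite !tech5, IHn, !(S_INR (S n)); ring. }
    destruct (growing_cv (sum_f_R0 (ret_time_term k b0 b1 b2 s))) as [m Hm].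
    + intros n; simpl; destruct (Ht (S n)); lra.
    + exists (/ b0 * W); intros r [n ->].
      apply Rle_trans with (/ b0 * sum_f_R0 (fun i => INR (S i) * (surv i s - surv (S i) s)) n).
      * rewrite scal_sum; apply sum_Rle; intros i _; rewrite Rmult_comm; apply Ht.
      * apply Rmult_le_compat_l; [apply Rlt_le, Rinv_0_lt_compat; lra|].
        rewrite Habel; specialize (HW n).
        assert (0 <= INR (S n) * surv (S n) s)
          by (apply Rmult_le_pos; [apply pos_INR|apply surv_nonneg]).
        lra.
    + exists m; exact Hm.
Qed.

End Target.
End Chain.

(** * Heights and the Foster criterion *)

Lemma Rsum_seq_S (f : nat -> R) a n : Rsum f (seq a (S n)) = Rsum f (seq a n) + f (a + n)%nat.
Proof. rewrite seq_S, Rsum_app; unfold Rsum at 2; simpl; lra. Qed.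

Lemma Rsum_seq_shift (f : nat -> R) a n :
  Rsum f (seq (S a) n) = Rsum (fun i => f (S i)) (seq a n).
Proof. rewrite <- seq_shift; apply Rsum_map. Qed.

Lemma sum_f_R0_Rsum (f : nat -> R) n : sum_f_R0 f n = Rsum f (seq 0 (S n)).
Proof.
  induction n as [|n IH]; [unfold Rsum; simpl; lra|].
  rewrite Rsum_seq_S, tech5, IH; reflexivity.
Qed.

Definition bump (x : nat -> Z) (j : nat) : nat -> Z :=
  fun i => if (i =? j)%nat then (x i + 1)%Z else x i.

(** Heights are determined by the shape only up to a common constant and may be negative; they give
    each site its own weight, on which the Lyapunov function is built. *)
Definition represents (x : nat -> Z) (h : shape) : Prop :=
  forall i, (1 <= i)%nat -> h i = (x i - x (S i))%Z.

Fixpoint height (h : shape) (i : nat) : Z :=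
  match i with O => 0%Z | S i' => (height h i' - h i')%Z end.

Lemma height_represents h : represents (height h) h.
Proof. intros i _; simpl; lia. Qed.

Lemma represents_jump x h j :
  (1 <= j)%nat -> represents x h -> represents (bump x j) (jump h j).
Proof.
  intros Hj Hx i Hi; unfold bump, jump; rewrite (Hx i Hi).
  destruct (Nat.eqb_spec i j), (Nat.eqb_spec (S i) j), (Nat.eqb_spec i (j - 1)),
    (Nat.leb_spec 2 j); simpl; lia.
Qed.

Definition Vx (k : nat) (x : nat -> Z) (j : nat) : nat :=
  ((if (2 <=? j)%nat && (x j <? x (j - 1)%nat)%Z then 1 else 0)
   + (if (j <=? k - 1)%nat && (x j <? x (S j))%Z then 1 else 0))%nat.

Lemma Vj_represents k x h j : (1 <= j)%nat -> represents x h -> Vj k h j = Vx k x j.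
Proof.
  intros Hj Hx; unfold Vj, Vx; rewrite (Hx j Hj); f_equal.
  - destruct (Nat.leb_spec 2 j) as [H|H]; [|reflexivity].
    rewrite (Hx (j - 1)%nat) by lia; replace (S (j - 1)) with j by lia; simpl.
    destruct (Z.ltb_spec 0 (x (j - 1)%nat - x j)), (Z.ltb_spec (x j) (x (j - 1)%nat)); lia.
  - destruct (Nat.leb_spec j (k - 1)) as [H|H]; [|reflexivity]; simpl.
    destruct (Z.ltb_spec (x j - x (S j)) 0), (Z.ltb_spec (x j) (x (S j))); lia.
Qed.

(** A jump at [i] raises entry [i] and a jump at [S i] lowers it, so only the number of jumps at
    each site matters, not their order. *)
Lemma path_end_count h p i :
  (1 <= i)%nat ->
  path_end h p i = (h i + Z.of_nat (count_occ Nat.eq_dec p i)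
                    - Z.of_nat (count_occ Nat.eq_dec p (S i)))%Z.
Proof.
  intros Hi; revert h; induction p as [|j p IH]; intros h; [simpl; lia|].
  simpl path_end; rewrite IH; unfold jump; simpl count_occ.
  destruct (Nat.eq_dec j i), (Nat.eq_dec j (S i)), (Nat.eqb_spec i j),
    (Nat.eqb_spec i (j - 1)), (Nat.leb_spec 2 j); simpl; lia.
Qed.

Fixpoint jump_word (d : nat -> nat) (n : nat) : list nat :=
  match n with O => [] | S n' => jump_word d n' ++ repeat n (d n) end.

Lemma jump_word_in d n j : In j (jump_word d n) -> (1 <= j <= n)%nat.
Proof.
  induction n as [|n IH]; simpl; [tauto|].
  rewrite in_app_iff; intros [H|H]; [specialize (IH H); lia|].
  apply repeat_spec in H; lia.
Qed.

Lemma jump_word_count d n i :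
  (1 <= i <= n)%nat -> count_occ Nat.eq_dec (jump_word d n) i = d i.
Proof.
  induction n as [|n IH]; intros Hi; [lia|]; simpl jump_word; rewrite count_occ_app.
  destruct (Nat.eq_dec i (S n)) as [->|Hn].
  - rewrite count_occ_repeat_eq by reflexivity.
    rewrite (proj1 (count_occ_not_In Nat.eq_dec _ _)); [reflexivity|].
    intros H; apply jump_word_in in H; lia.
  - rewrite count_occ_repeat_neq, IH by lia; lia.
Qed.

Lemma jump_word_length d n m :
  (forall i, (1 <= i <= n)%nat -> (d i <= m)%nat) -> (length (jump_word d n) <= n * m)%nat.
Proof.
  induction n as [|n IH]; intros H; simpl jump_word; [simpl; lia|].
  rewrite length_app, repeat_length.
  specialize (IH (fun i Hi => H i ltac:(lia))); specialize (H (S n) ltac:(lia)); lia.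
Qed.

Lemma finite_Zbound (f : nat -> Z) n : exists B, forall i, (i <= n)%nat -> (Z.abs (f i) <= B)%Z.
Proof.
  induction n as [|n [B HB]].
  - exists (Z.abs (f 0%nat)); intros i Hi; replace i with 0%nat by lia; lia.
  - exists (Z.max B (Z.abs (f (S n)))); intros i Hi.
    destruct (Nat.eq_dec i (S n)) as [->|]; [lia|]; specialize (HB i ltac:(lia)); lia.
Qed.

(** Sites can only grow, so the target profile is lifted by a large [t] and every site is filled up
    to it; bounded slopes make the number of jumps uniformly bounded. *)
Lemma reach_target (k : nat) (s : shape) (B : Z) :
  (1 <= k)%nat -> exists N, forall x h, represents x h ->
  (forall i, (1 <= i <= k - 1)%nat -> (Z.abs (x i - x (S i)) <= B)%Z) ->
  exists p, p <> [] /\ (forall j, In j p -> (1 <= j <= k)%nat) /\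
            same_shape k (path_end h p) s = true /\ (length p <= N)%nat.
Proof.
  intros hk.
  destruct (finite_Zbound (fun i => height s i - height s 1)%Z k) as [A HA].
  (* The first term bounds the heights relative to site 1, [A] does so for the target, and the extra
     1 makes every site jump at least once, so that the word is nonempty. *)
  set (t := (Z.of_nat k * Z.abs B + A + 1)%Z).
  exists (k * Z.to_nat (2 * t))%nat; intros x h Hx HB.
  assert (Hosc : forall i, (1 <= i <= k)%nat -> (Z.abs (x i - x 1%nat) <= Z.of_nat i * Z.abs B)%Z).
  { induction i as [|i IH]; intros Hi; [lia|].
    destruct i as [|i]; [lia|].
    specialize (IH ltac:(lia)); specialize (HB (S i) ltac:(lia)); lia. }
  set (d := fun i => (t + (height s i - height s 1) - (x i - x 1%nat))%Z).
  assert (Hd : forall i, (1 <= i <= k)%nat -> (1 <= d i <= 2 * t)%Z).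
  { intros i Hi; specialize (Hosc i Hi); specialize (HA i ltac:(lia)); simpl in HA.
    assert (Z.of_nat i * Z.abs B <= Z.of_nat k * Z.abs B)%Z
      by (apply Z.mul_le_mono_nonneg_r; lia).
    unfold d, t in *; cbn [height] in *; lia. }
  set (p := jump_word (fun i => Z.to_nat (d i)) k).
  exists p; split; [|split; [|split]].
  - intros E; assert (H : count_occ Nat.eq_dec p 1%nat = Z.to_nat (d 1%nat))
      by (apply jump_word_count; lia).
    rewrite E in H; simpl in H; specialize (Hd 1%nat ltac:(lia)); lia.
  - intros j; apply jump_word_in.
  - unfold same_shape; apply forallb_forall; intros i Hi; apply in_seq in Hi.
    apply Z.eqb_eq; rewrite path_end_count by lia; unfold p.
    rewrite !jump_word_count by lia.
    pose proof (Hd i ltac:(lia)); pose proof (Hd (S i) ltac:(lia)).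
    rewrite !Z2Nat.id by lia; rewrite (Hx i) by lia; unfold d; simpl; lia.
  - apply jump_word_length; intros i Hi; specialize (Hd i Hi); lia.
Qed.

(** * Foster's criterion for the jump chain *)

Section Foster.

Variables (k : nat) (b0 b1 b2 : R).
Hypotheses (hk : (1 <= k)%nat) (h0 : 0 < b0) (h02 : b0 < b2) (h21 : b2 < b1).

Definition xrate (x : nat -> Z) (j : nat) : R := beta_of b0 b1 b2 (Vx k x j).

Definition gen (F : (nat -> Z) -> R) (x : nat -> Z) : R :=
  Rsum (fun j => xrate x j * (F (bump x j) - F x)) (seq 1 k).

Variables (F : (nat -> Z) -> R) (eps C : R).
Hypotheses
  (heps : 0 < eps)
  (F_nonneg : forall x, 0 <= F x)
  (F_drift : forall x, gen F x <= - eps * F x + C)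
  (F_coercive : forall M, exists B, forall x, F x <= M ->
     forall i, (1 <= i <= k - 1)%nat -> (Z.abs (x i - x (S i)) <= B)%Z).

(** Carries the drift of the continuous-time generator over to the embedded chain. *)
Lemma jump_mean x h : represents x h ->
  Rsum (fun j => jprob k b0 b1 b2 h j * F (bump x j)) (seq 1 k) =
  F x + gen F x / qtot k b0 b1 b2 h.
Proof.
  intros Hx.
  replace (F x) with (F x * Rsum (jprob k b0 b1 b2 h) (seq 1 k))
    by (rewrite (jprob_total k b0 b1 b2 hk h0 h02 h21 h); ring).
  unfold gen, Rdiv; rewrite (Rmult_comm (Rsum _ _) (/ _)), <- !Rsum_scal, <- Rsum_plus.
  apply Rsum_ext_in; intros j Hj; apply in_seq in Hj.
  unfold jprob, rate, xrate, Rdiv; rewrite (Vj_represents k x h j) by (auto; lia).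
  ring.
Qed.

(** Above a level [M], the multiple [c * F] falls by at least 1 on average per jump; below it, [s]
    is reached within [N] jumps with probability bounded below. Adding a multiple of the hitting
    time truncated at [N] yields a function that loses at least 1 per jump everywhere, and so bounds
    the sum of the survival probabilities. *)
Lemma foster : shape_ergodic k b0 b1 b2.
Proof.
  intros s.
  set (u := surv k b0 b1 b2 s).
  set (C' := Rmax C 0).
  assert (HC : C <= C' /\ 0 <= C') by (split; [apply Rmax_l|apply Rmax_r]).
  (* Above this level the drift of [F] is at most [-1]. *)
  set (M := (C' + 1) / eps).
  destruct (F_coercive M) as [B HB].
  destruct (reach_target k s B hk) as [N HN].
  set (q := jprob_min k b0 b1).
  assert (Hq : 0 < q) by now apply jprob_min_pos with (b2 := b2).
  assert (Hq1 : q <= 1).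
  { apply Rle_trans with (jprob k b0 b1 b2 s 1); [now apply jprob_ge|].
    rewrite <- (jprob_total k b0 b1 b2 hk h0 h02 h21 s); apply Rsum_ge_term.
    - intros i _; apply Rlt_le; now apply jprob_pos.
    - apply in_seq; lia. }
  assert (Heta : 0 < q ^ N) by now apply pow_lt.
  assert (Hu : forall x h, represents x h -> F x <= M -> u N h <= 1 - q ^ N).
  { intros x h Hx HM.
    destruct (HN x h Hx (HB x HM)) as (p & Hp & Hpk & Hps & Hpl).
    apply Rle_trans with (u (length p) h); [now apply surv_antitone|].
    apply Rle_trans with (1 - q ^ length p); [now apply surv_path|].
    assert (q ^ N <= q ^ length p); [|lra].
    replace N with (length p + (N - length p))%nat by lia; rewrite pow_add.
    rewrite <- (Rmult_1_r (q ^ length p)) at 2.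
    apply Rmult_le_compat_l; [apply pow_le; lra|].
    rewrite <- (pow1 (N - length p)); apply pow_incr; lra. }
  (* [c] bounds the total rate, so a generator drift of [-1] lowers [c * F] by at least 1 per
     jump. *)
  set (c := INR k * b1).
  assert (Hc : 0 < c) by (unfold c; apply k_b1_pos with b0 b2; auto).
  (* [K * q ^ N] pays for the current jump and for the largest mean increase of [c * F] below level
     [M]. *)
  set (K := (1 + c * (C' / b0)) / q ^ N).
  assert (HCb : 0 <= C' / b0).
  { apply Rmult_le_pos; [apply HC|apply Rlt_le, Rinv_0_lt_compat; lra]. }
  assert (HK : 0 <= K).
  { unfold K, Rdiv; apply Rmult_le_pos; [|apply Rlt_le, Rinv_0_lt_compat; lra].
    assert (0 <= c * (C' / b0)) by (apply Rmult_le_pos; lra); lra. }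
  assert (HKq : K * q ^ N = 1 + c * (C' / b0)).
  { unfold K, Rdiv; rewrite Rmult_assoc, Rinv_l by lra; ring. }
  (* [T n h] is the mean of the hitting time of [s] truncated at [n]. *)
  set (T := fun n h => Rsum (fun i => u i h) (seq 0 n)).
  assert (HT : forall n h, T (S n) h = 1 +
    Rsum (fun j => jprob k b0 b1 b2 h j *
            (if same_shape k (jump h j) s then 0 else T n (jump h j))) (seq 1 k)).
  { induction n as [|n IH]; intros h.
    - rewrite Rsum_zero; [unfold T, Rsum; simpl; lra|].
      intros j _; destruct (same_shape k (jump h j) s); unfold T, Rsum; simpl; lra.
    - unfold T at 1; rewrite Rsum_seq_S; fold (T (S n) h); rewrite IH, Rplus_assoc.
      f_equal; unfold u at 1; simpl surv; rewrite <- Rsum_plus.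
      apply Rsum_ext_in; intros j _.
      replace (T (S n) (jump h j)) with (T n (jump h j) + u n (jump h j))
        by (unfold T; rewrite Rsum_seq_S; reflexivity).
      unfold u; destruct (same_shape k (jump h j) s); ring. }
  assert (HT0 : forall n h, 0 <= T n h)
    by (intros; apply Rsum_nonneg; intros; now apply surv_nonneg).
  (* One jump of the chain stopped at [s] changes the mean of [T N] by [u N h - 1], which is at most
     [- q ^ N] below level [M] and at most 0 elsewhere. *)
  assert (Hmain : forall n x h, represents x h -> T n h <= c * F x + K * T N h).
  { induction n as [|n IH]; intros x h Hx.
    - unfold T at 1, Rsum; simpl.
      apply Rplus_le_le_0_compat; apply Rmult_le_pos; auto; lra.
    - rewrite HT.
      apply Rle_trans with (1 + (c * (F x + gen F x / qtot k b0 b1 b2 h)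
                                 + K * (T (S N) h - 1))).
      + apply Rplus_le_compat_l; rewrite HT, <- (jump_mean x h Hx).
        replace (1 + _ - 1) with
          (Rsum (fun j => jprob k b0 b1 b2 h j *
             (if same_shape k (jump h j) s then 0 else T N (jump h j))) (seq 1 k)) by ring.
        rewrite <- !Rsum_scal, <- Rsum_plus; apply Rsum_le; intros j Hj; apply in_seq in Hj.
        assert (Hp := jprob_pos k b0 b1 b2 hk h0 h02 h21 h j).
        assert (Hb := F_nonneg (bump x j)).
        destruct (same_shape k (jump h j) s).
        * rewrite !Rmult_0_r, Rplus_0_r; apply Rmult_le_pos; [lra|apply Rmult_le_pos; lra].
        * assert (Hj' := IH (bump x j) (jump h j) (represents_jump x h j ltac:(lia) Hx)).
          apply Rmult_le_compat_l with (r := jprob k b0 b1 b2 h j) in Hj'; lra.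
      + replace (T (S N) h) with (T N h + u N h) by (unfold T; now rewrite Rsum_seq_S).
        assert (HuN : u N h <= 1) by now apply surv_le_1.
        destruct (qtot_bounds k b0 b1 b2 hk h0 h02 h21 h) as [Hq0 Hq'].
        assert (Hd := F_drift x); assert (HF := F_nonneg x).
        assert (Hi : 0 < / qtot k b0 b1 b2 h) by (apply Rinv_0_lt_compat; lra).
        destruct (Rle_lt_dec (F x) M) as [HM|HM].
        * specialize (Hu x h Hx HM).
          assert (Hg : gen F x / qtot k b0 b1 b2 h <= C' / b0).
          { assert (gen F x <= C') by nra.
            apply Rle_trans with (C' * / qtot k b0 b1 b2 h).
            - apply Rmult_le_compat_r; lra.
            - apply Rmult_le_compat_l; [apply HC|apply Rinv_le_contravar; lra]. }
          assert (K * (u N h - 1) <= - (K * q ^ N)) by nra.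
          assert (c * (gen F x / qtot k b0 b1 b2 h) <= c * (C' / b0))
            by (apply Rmult_le_compat_l; lra).
          lra.
        * assert (Hg : gen F x <= -1).
          { assert (C' + 1 < eps * F x); [|lra].
            unfold M in HM; apply Rmult_lt_compat_l with (r := eps) in HM; auto.
            unfold Rdiv in HM; rewrite (Rmult_comm (C' + 1)), <- Rmult_assoc, Rinv_r in HM; lra. }
          assert (c * (gen F x / qtot k b0 b1 b2 h) <= -1).
          { assert (1 <= c * / qtot k b0 b1 b2 h).
            { apply Rmult_le_reg_r with (qtot k b0 b1 b2 h); [lra|].
              rewrite Rmult_assoc, Rinv_l by lra; unfold c; lra. }
            unfold Rdiv; nra. }
          assert (K * (u N h - 1) <= 0) by nra.
          lra. }
  apply (pos_recurrent_of_surv_summable k b0 b1 b2 hk h0 h02 h21 s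
           (c * F (height s) + K * T N s)).
  intros n; rewrite sum_f_R0_Rsum; apply Hmain, height_represents.
Qed.

End Foster.

(** * Lyapunov function from interval potentials *)

Lemma finite_argmax (f : nat -> R) (l m : nat) :
  (1 <= m)%nat ->
  exists p, (l <= p < l + m)%nat /\ forall i, (l <= i < l + m)%nat -> f i <= f p.
Proof.
  induction m as [|m IH]; intros Hm; [lia|].
  destruct m as [|m].
  - exists l; split; [lia|]; intros i Hi; replace i with l by lia; apply Rle_refl.
  - destruct (IH ltac:(lia)) as (p & Hp & Hmax).
    destruct (Rle_lt_dec (f p) (f (l + S m)%nat)) as [H|H].
    + exists (l + S m)%nat; split; [lia|]; intros i Hi.
      destruct (Nat.eq_dec i (l + S m)) as [->|]; [apply Rle_refl|].
      apply Rle_trans with (f p); auto; apply Hmax; lia.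
    + exists p; split; [lia|]; intros i Hi.
      destruct (Nat.eq_dec i (l + S m)) as [->|]; [lra|apply Hmax; lia].
Qed.

(** * Exponential weights of the sites *)

Section Weights.

Variables (k : nat) (theta : R).
Hypothesis htheta : 0 < theta.

Definition wt (x : nat -> Z) (j : nat) : R :=
  if ((1 <=? j) && (j <=? k))%nat then exp (theta * IZR (x j)) else 0.

Lemma wt_in x j : (1 <= j <= k)%nat -> wt x j = exp (theta * IZR (x j)).
Proof.
  intros Hj; unfold wt; destruct (Nat.leb_spec 1 j), (Nat.leb_spec j k); auto; lia.
Qed.

Lemma wt_out x j : ~ (1 <= j <= k)%nat -> wt x j = 0.
Proof.
  intros Hj; unfold wt; destruct (Nat.leb_spec 1 j), (Nat.leb_spec j k); auto; lia.
Qed.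

Lemma wt_pos x j : (1 <= j <= k)%nat -> 0 < wt x j.
Proof. intros Hj; rewrite wt_in by exact Hj; apply exp_pos. Qed.

Lemma wt_nonneg x j : 0 <= wt x j.
Proof.
  unfold wt; destruct (_ && _); [apply Rlt_le, exp_pos|apply Rle_refl].
Qed.

Lemma wt_pos_inv x j : 0 < wt x j -> (1 <= j <= k)%nat.
Proof.
  unfold wt; destruct (Nat.leb_spec 1 j), (Nat.leb_spec j k); simpl; auto; lra.
Qed.

Lemma wt_bump_eq x j : wt (bump x j) j = exp theta * wt x j.
Proof.
  unfold wt, bump; rewrite Nat.eqb_refl; destruct (_ && _); [|ring].
  rewrite <- exp_plus, plus_IZR; f_equal; ring.
Qed.

Lemma wt_bump_neq x j i : i <> j -> wt (bump x j) i = wt x i.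
Proof.
  intros H; unfold wt, bump; destruct (Nat.eqb_spec i j); [contradiction|reflexivity].
Qed.

Lemma exp_theta_gt_1 : 1 < exp theta.
Proof. rewrite <- exp_0; now apply exp_increasing. Qed.

Lemma wt_bump_le x j i : wt x i <= wt (bump x j) i.
Proof.
  destruct (Nat.eq_dec i j) as [->|H].
  - rewrite wt_bump_eq; generalize exp_theta_gt_1 (wt_nonneg x j); nra.
  - rewrite wt_bump_neq by exact H; lra.
Qed.

Lemma wt_lt_inv x i j : (1 <= i <= k)%nat -> wt x i < wt x j -> (x i < x j)%Z.
Proof.
  intros Hi H; assert (Hj : (1 <= j <= k)%nat) by
    (apply (wt_pos_inv x); generalize (wt_nonneg x i); lra).
  rewrite !wt_in in H by assumption; apply exp_lt_inv in H.
  apply lt_IZR; nra.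
Qed.

Lemma wt_lt_mono x i j :
  (1 <= i <= k)%nat -> (1 <= j <= k)%nat -> (x i < x j)%Z -> wt x i < wt x j.
Proof.
  intros Hi Hj H; rewrite !wt_in by assumption.
  apply exp_increasing, Rmult_lt_compat_l, IZR_lt; assumption.
Qed.

(** Heights are integers, so a strict inequality between weights leaves room for one jump: the lower
    site does not overtake the other. *)
Lemma wt_lt_step x i j : wt x i < wt x j -> exp theta * wt x i <= wt x j.
Proof.
  intros H; assert (Hj : (1 <= j <= k)%nat) by
    (apply (wt_pos_inv x); generalize (wt_nonneg x i); lra).
  destruct (Nat.le_gt_cases 1 i) as [H1|H1];
    [destruct (Nat.le_gt_cases i k) as [H2|H2]|];
    try (rewrite (wt_out x i) in * by lia; lra).
  assert (Hx := wt_lt_inv x i j (conj H1 H2) H).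
  rewrite !wt_in, <- exp_plus by lia.
  assert (Hx' : IZR (x i) + 1 <= IZR (x j)) by (rewrite <- plus_IZR; apply IZR_le; lia).
  assert (He : theta + theta * IZR (x i) <= theta * IZR (x j)) by nra.
  destruct He as [He| ->]; [apply Rlt_le, exp_increasing, He|apply Rle_refl].
Qed.

Definition nbr (l m : nat) (x : nat -> Z) : R := Rmax (wt x (l - 1)) (wt x (l + m)).

Lemma nbr_pos l m x : (1 <= l)%nat -> (l + m <= k + 1)%nat -> (m < k)%nat -> 0 < nbr l m x.
Proof.
  intros Hl Hm Hk; unfold nbr.
  destruct (Nat.le_gt_cases (l + m) k).
  - apply Rlt_le_trans with (2 := Rmax_r _ _), wt_pos; lia.
  - apply Rlt_le_trans with (2 := Rmax_l _ _), wt_pos; lia.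
Qed.

End Weights.

(** * Drift of the interval ratios *)

Section Lyapunov.

Variables (k : nat) (b0 b1 b2 : R).
Hypotheses (hk : (2 <= k)%nat) (h0 : 0 < b0) (h02 : b0 < b2) (h21 : b2 < b1).

Lemma xrate_pos x j : 0 < xrate k b0 b1 b2 x j.
Proof.
  generalize (beta_of_bounds b0 b1 b2 h02 h21 (Vx k x j)); unfold xrate; lra.
Qed.

Lemma xrate_le x j : xrate k b0 b1 b2 x j <= b1.
Proof. apply beta_of_bounds; assumption. Qed.

Lemma gen_plus F G x :
  gen k b0 b1 b2 (fun z => F z + G z) x = gen k b0 b1 b2 F x + gen k b0 b1 b2 G x.
Proof.
  unfold gen; rewrite <- Rsum_plus; apply Rsum_ext_in; intros; ring.
Qed.

Lemma gen_scal c F x :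
  gen k b0 b1 b2 (fun z => c * F z) x = c * gen k b0 b1 b2 F x.
Proof.
  unfold gen; rewrite <- Rsum_scal; apply Rsum_ext_in; intros; ring.
Qed.

Lemma gen_const c x : gen k b0 b1 b2 (fun _ => c) x = 0.
Proof. apply Rsum_zero; intros; ring. Qed.

Lemma gen_Rsum {A} (F : A -> (nat -> Z) -> R) l x :
  gen k b0 b1 b2 (fun z => Rsum (fun a => F a z) l) x =
  Rsum (fun a => gen k b0 b1 b2 (F a) x) l.
Proof.
  induction l as [|a l IH]; [exact (gen_const 0 x)|].
  rewrite Rsum_cons, <- IH, <- gen_plus; reflexivity.
Qed.

Variables (theta delta C : R) (Phi : nat -> nat -> (nat -> Z) -> R).
Hypotheses (htheta : 0 < theta) (hdelta : 0 < delta) (hC : 0 < C).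

Local Notation y := (wt k theta).
Local Notation Y := (nbr k theta).
Local Notation r := (xrate k b0 b1 b2).
Local Notation L := (gen k b0 b1 b2).

(* Guaranteed rate of a site neighbouring an interval of size [m] and lower than
   it: when [m = k - 1] that site is 1 or [k] and has only one neighbour. *)
Definition nbr_rate (m : nat) : R := if (m =? k - 1)%nat then b1 else b2.

(** What the common argument asks of a potential: [Phi_drift] bounds its speed, the peeling bounds
    drop an end site, and [Phi_ge] serves to control height differences. *)
Hypotheses
  (Phi_0 : forall l x, Phi l 0 x = 0)
  (Phi_nonneg : forall l m x, 0 <= Phi l m x)
  (Phi_local : forall l m x j, ~ (l <= j < l + m)%nat -> Phi l m (bump x j) = Phi l m x)
  (Phi_drift : forall l m x, (1 <= l)%nat -> (1 <= m < k)%nat -> (l + m <= k + 1)%nat ->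
     L (Phi l m) x <= ((1 - exp (- theta)) * nbr_rate m - delta) * Phi l m x
                        + C * Y l m x)
  (Phi_peel_r : forall l m x, (1 <= l)%nat -> (l + S m <= k + 1)%nat ->
     Phi l (S m) x <= C * (Phi l m x + y x (l + m)))
  (Phi_peel_l : forall l m x, (1 <= l)%nat -> (l + S m <= k + 1)%nat ->
     Phi l (S m) x <= C * (Phi (S l) m x + y x l))
  (Phi_ge : forall l m x t, (1 <= l)%nat -> (1 <= m)%nat -> (l + m <= k + 1)%nat ->
     (forall j, (l <= j < l + m)%nat -> t <= y x j) -> t <= Phi l m x).

(** The ratio Q_J. Intervals overrunning [k] get the value 0, so that sums may run over all left
    ends [1..k]. *)
Definition excess (l m : nat) (x : nat -> Z) : R :=
  if (l + m <=? k + 1)%nat then Phi l m x / Y l m x else 0.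

Lemma excess_in l m x : (l + m <= k + 1)%nat -> excess l m x = Phi l m x / Y l m x.
Proof. intros H; unfold excess; destruct (Nat.leb_spec (l + m) (k + 1)); [auto|lia]. Qed.

Lemma excess_out l m x : (k + 1 < l + m)%nat -> excess l m x = 0.
Proof. intros H; unfold excess; destruct (Nat.leb_spec (l + m) (k + 1)); [lia|auto]. Qed.

Lemma excess_0 l x : excess l 0 x = 0.
Proof. unfold excess; rewrite Phi_0; destruct (_ <=? _)%nat; unfold Rdiv; ring. Qed.

Lemma excess_nonneg l m x : (1 <= l)%nat -> (m < k)%nat -> 0 <= excess l m x.
Proof.
  intros Hl Hm; destruct (Nat.le_gt_cases (l + m) (k + 1)) as [H|H].
  - rewrite excess_in by exact H; apply Rmult_le_pos; [apply Phi_nonneg|].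
    apply Rlt_le, Rinv_0_lt_compat; now apply nbr_pos.
  - rewrite excess_out by exact H; apply Rle_refl.
Qed.

(** No jump changes [Phi] and [Y] together: inside the interval only [Phi] moves, a jump at the
    higher neighbour [i] multiplies [Y] by at least [exp theta], and no other jump lowers [Y]. *)
Lemma excess_jump l m x i j :
  (1 <= l)%nat -> (1 <= m < k)%nat -> (l + m <= k + 1)%nat ->
  (i = l - 1 \/ i = l + m)%nat -> y x i = Y l m x ->
  excess l m (bump x j) - excess l m x <=
  (Phi l m (bump x j) - Phi l m x) / Y l m x
  + (if (j =? i)%nat then - (1 - exp (- theta)) * excess l m x else 0).
Proof.
  intros Hl Hm Hlm Hi Hwi.
  assert (HN := nbr_pos k theta l m x Hl Hlm ltac:(lia)).
  assert (HN' := nbr_pos k theta l m (bump x j) Hl Hlm ltac:(lia)).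
  assert (HP := Phi_nonneg l m x).
  rewrite !excess_in by exact Hlm.
  destruct (Nat.eqb_spec j i) as [->|Hj].
  - rewrite Phi_local by lia.
    assert (H : exp theta * Y l m x <= Y l m (bump x i)).
    { rewrite <- Hwi, <- wt_bump_eq; unfold nbr.
      destruct Hi; subst i; [apply Rmax_l|apply Rmax_r]. }
    assert (He := exp_pos theta).
    assert (H' : / Y l m (bump x i) <= exp (- theta) * / Y l m x).
    { rewrite exp_Ropp, <- Rinv_mult; apply Rinv_le_contravar; [|exact H].
      now apply Rmult_lt_0_compat. }
    apply Rmult_le_compat_l with (r := Phi l m x) in H'; [|exact HP].
    unfold Rdiv; lra.
  - destruct (Nat.le_gt_cases l j) as [H1|H1];
      [destruct (Nat.le_gt_cases (l + m) j) as [H2|H2]|].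
    2: { replace (Y l m (bump x j)) with (Y l m x)
           by (unfold nbr; rewrite !wt_bump_neq by lia; reflexivity).
         unfold Rdiv; lra. }
    all: rewrite Phi_local by lia.
    all: assert (H : / Y l m (bump x j) <= / Y l m x) by
      (apply Rinv_le_contravar; [exact HN|];
       apply Rmax_lub;
       [apply Rle_trans with (2 := Rmax_l _ _)|apply Rle_trans with (2 := Rmax_r _ _)];
       now apply wt_bump_le).
    all: apply Rmult_le_compat_l with (r := Phi l m x) in H; [|exact HP].
    all: unfold Rdiv; lra.
Qed.

Lemma nbr_rate_le m : nbr_rate m <= b1.
Proof. unfold nbr_rate; destruct (_ =? _)%nat; lra. Qed.

Lemma xrate_nbr_r l m x :
  (1 <= l)%nat -> (1 <= m < k)%nat -> (l + m <= k)%nat ->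
  y x (l + m) < y x (l + m - 1) -> nbr_rate m <= r x (l + m).
Proof.
  intros Hl Hm Hlm H; apply wt_lt_inv in H; [|assumption|lia].
  unfold nbr_rate, xrate, Vx.
  destruct (Nat.leb_spec 2 (l + m)); [|lia].
  destruct (Z.ltb_spec (x (l + m)%nat) (x (l + m - 1)%nat)); [|lia].
  destruct (Nat.eqb_spec m (k - 1)), (Nat.leb_spec (l + m) (k - 1)); try lia; simpl;
    try destruct (_ <? _)%Z; simpl; lra.
Qed.

Lemma xrate_nbr_l l m x :
  (2 <= l)%nat -> (1 <= m < k)%nat -> (l + m <= k + 1)%nat ->
  y x (l - 1) < y x l -> nbr_rate m <= r x (l - 1).
Proof.
  intros Hl Hm Hlm H; apply wt_lt_inv in H; [|assumption|lia].
  unfold nbr_rate, xrate, Vx.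
  destruct (Nat.leb_spec (l - 1) (k - 1)); [|lia].
  replace (S (l - 1)) with l by lia.
  destruct (Z.ltb_spec (x (l - 1)%nat) (x l)); [|lia].
  destruct (Nat.eqb_spec m (k - 1)), (Nat.leb_spec 2 (l - 1)); try lia; simpl;
    try destruct (_ <? _)%Z; simpl; lra.
Qed.

Lemma exp_opp_bounds : 0 < exp (- theta) < 1.
Proof.
  split; [apply exp_pos|]; rewrite <- exp_0; apply exp_increasing; lra.
Qed.

(** The rise of the interval competes with that of its higher neighbour [i], each jump of which
    removes at least a fraction [1 - exp (- theta)] of the ratio. *)
Lemma excess_drift_at l m x i :
  (1 <= l)%nat -> (1 <= m < k)%nat -> (l + m <= k + 1)%nat ->
  (i = l - 1 \/ i = l + m)%nat -> y x i = Y l m x ->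
  L (excess l m) x <=
  ((1 - exp (- theta)) * (nbr_rate m - r x i) - delta) * excess l m x + C.
Proof.
  intros Hl Hm Hlm Hi Hwi.
  assert (HN := nbr_pos k theta l m x Hl Hlm ltac:(lia)).
  assert (Hik : (1 <= i <= k)%nat) by (apply (wt_pos_inv k theta x); lra).
  assert (Hgen : L (excess l m) x <=
            / Y l m x * L (Phi l m) x
            + r x i * (- (1 - exp (- theta)) * excess l m x)).
  { replace (r x i * (- (1 - exp (- theta)) * excess l m x)) with
      (Rsum (fun j => r x j *
         (if (j =? i)%nat then - (1 - exp (- theta)) * excess l m x else 0)) (seq 1 k)).
    - unfold gen at 2; rewrite <- Rsum_scal, <- Rsum_plus; apply Rsum_le; intros j _.
      assert (H := excess_jump l m x i j Hl Hm Hlm Hi Hwi).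
      apply Rmult_le_compat_l with (r := r x j) in H; [|apply Rlt_le, xrate_pos].
      unfold Rdiv in H; lra.
    - rewrite (Rsum_single _ _ i); [|apply seq_NoDup|apply in_seq; lia|].
      + now rewrite Nat.eqb_refl.
      + intros j _ Hj; destruct (Nat.eqb_spec j i); [contradiction|ring]. }
  assert (HD := Phi_drift l m x Hl Hm Hlm).
  apply Rmult_le_compat_l with (r := / Y l m x) in HD;
    [|apply Rlt_le, Rinv_0_lt_compat, HN].
  assert (E : / Y l m x * (((1 - exp (- theta)) * nbr_rate m - delta) * Phi l m x
                             + C * Y l m x) =
              ((1 - exp (- theta)) * nbr_rate m - delta) * excess l m x + C).
  { rewrite excess_in by exact Hlm; field; lra. }
  lra.
Qed.

(** The denominator of the other interval is no larger, so it suffices to divide the peeling bound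
    by [Y l m x]. *)
Lemma excess_peel l m l' m' x i :
  (1 <= l)%nat -> (1 <= m < k)%nat -> (l + m <= k + 1)%nat ->
  (1 <= l')%nat -> (m' < k)%nat -> (l' + m' <= k + 1)%nat ->
  Y l' m' x <= Y l m x -> y x i <= Y l m x ->
  Phi l m x <= C * (Phi l' m' x + y x i) ->
  excess l m x <= C * (1 + excess l' m' x).
Proof.
  intros Hl Hm Hlm Hl' Hm' Hlm' Hn Hi HP.
  assert (HN := nbr_pos k theta l m x Hl Hlm ltac:(lia)).
  assert (HN' := nbr_pos k theta l' m' x Hl' Hlm' Hm').
  rewrite !excess_in by assumption.
  assert (H : / Y l m x <= / Y l' m' x) by (apply Rinv_le_contravar; lra).
  assert (Hi' : 0 < / Y l m x) by now apply Rinv_0_lt_compat.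
  apply Rmult_le_compat_r with (r := / Y l m x) in HP; [|lra].
  assert (H1 : y x i * / Y l m x <= 1).
  { rewrite <- (Rinv_r (Y l m x)) by lra; apply Rmult_le_compat_r; lra. }
  assert (H2 : Phi l' m' x * / Y l m x <= Phi l' m' x * / Y l' m' x)
    by (apply Rmult_le_compat_l; [apply Phi_nonneg|exact H]).
  unfold Rdiv.
  apply Rle_trans with (1 := HP).
  rewrite Rmult_assoc; apply Rmult_le_compat_l; lra.
Qed.

(** Either the higher neighbour is below the adjacent site of the interval and rises at rate at
    least [nbr_rate m], or that adjacent site is no higher than the neighbour and can be peeled
    off. *)
Lemma excess_drift l m x :
  (1 <= l)%nat -> (1 <= m < k)%nat ->
  L (excess l m) x <=
  - delta * excess l m x
  + C * (1 + b1) * (1 + excess l (m - 1) x + excess (S l) (m - 1) x).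
Proof.
  intros Hl Hm.
  assert (Hq1 := excess_nonneg l (m - 1) x Hl ltac:(lia)).
  assert (Hq2 := excess_nonneg (S l) (m - 1) x ltac:(lia) ltac:(lia)).
  assert (Hq := excess_nonneg l m x Hl ltac:(lia)).
  assert (HCb : 0 < C * b1) by (apply Rmult_lt_0_compat; lra).
  destruct (Nat.le_gt_cases (l + m) (k + 1)) as [Hlm|Hlm].
  2: { rewrite (excess_out l m x Hlm).
       replace (L (excess l m) x) with 0; [nra|].
       symmetry; apply Rsum_zero; intros j _; rewrite !excess_out by exact Hlm; ring. }
  assert (He := exp_opp_bounds).
  assert (Hnr := nbr_rate_le m).
  assert (Hnr0 : 0 < nbr_rate m) by (unfold nbr_rate; destruct (_ =? _)%nat; lra).
  assert (HN := nbr_pos k theta l m x Hl Hlm ltac:(lia)).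
  (* The neighbour rises fast enough to leave a drift of at most [- delta] times the ratio, plus
     [C]. *)
  assert (Hgood : forall i, (i = l - 1 \/ i = l + m)%nat -> y x i = Y l m x ->
            nbr_rate m <= r x i ->
            L (excess l m) x <= - delta * excess l m x
              + C * (1 + b1) * (1 + excess l (m - 1) x + excess (S l) (m - 1) x)).
  { intros i Hi Hwi Hr; apply Rle_trans with (1 := excess_drift_at l m x i Hl Hm Hlm Hi Hwi).
    assert ((1 - exp (- theta)) * (r x i - nbr_rate m) >= 0) by nra.
    assert (0 <= (1 - exp (- theta)) * (r x i - nbr_rate m) * excess l m x)
      by (apply Rmult_le_pos; lra).
    assert (0 <= C * b1 * (1 + excess l (m - 1) x + excess (S l) (m - 1) x))
      by (apply Rmult_le_pos; lra).
    assert (0 <= C * (excess l (m - 1) x + excess (S l) (m - 1) x))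
      by (apply Rmult_le_pos; lra).
    lra. }
  (* The neighbour may be slow; the possible growth, at most [b1] times the ratio, is then bounded
     through the shorter interval. *)
  assert (Hbad : forall i q, (i = l - 1 \/ i = l + m)%nat -> y x i = Y l m x ->
            q <= excess l (m - 1) x + excess (S l) (m - 1) x ->
            excess l m x <= C * (1 + q) ->
            L (excess l m) x <= - delta * excess l m x
              + C * (1 + b1) * (1 + excess l (m - 1) x + excess (S l) (m - 1) x)).
  { intros i q Hi Hwi Hqs Hp.
    apply Rle_trans with (1 := excess_drift_at l m x i Hl Hm Hlm Hi Hwi).
    assert (Hr := xrate_pos x i).
    assert ((1 - exp (- theta)) * (nbr_rate m - r x i) <= b1) by nra.
    assert ((1 - exp (- theta)) * (nbr_rate m - r x i) * excess l m x
            <= b1 * excess l m x) by (apply Rmult_le_compat_r; lra).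
    assert (b1 * excess l m x <=
            b1 * (C * (1 + (excess l (m - 1) x + excess (S l) (m - 1) x)))).
    { apply Rmult_le_compat_l; [lra|]; apply Rle_trans with (1 := Hp).
      apply Rmult_le_compat_l; lra. }
    assert (0 <= C * (excess l (m - 1) x + excess (S l) (m - 1) x))
      by (apply Rmult_le_pos; lra).
    lra. }
  destruct (Rle_lt_dec (y x (l + m)) (y x (l - 1))) as [H|H].
  - assert (Hi : y x (l - 1) = Y l m x) by (symmetry; apply Rmax_left, H).
    assert (Hl2 : (1 <= l - 1 <= k)%nat) by (apply (wt_pos_inv k theta x); lra).
    destruct (Rlt_le_dec (y x (l - 1)) (y x l)) as [Ha|Ha].
    + apply (Hgood (l - 1)%nat); auto; apply xrate_nbr_l; auto; lia.
    + apply (Hbad (l - 1)%nat (excess (S l) (m - 1) x)); auto; [lra|].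
      apply excess_peel with l; auto; try lia; try lra.
      (* The neighbours of the shortened interval are the peeled site and the old right neighbour,
         neither of them above the old left neighbour. *)
      * rewrite <- Hi; unfold nbr; apply Rmax_lub.
        -- replace (S l - 1)%nat with l by lia; exact Ha.
        -- replace (S l + (m - 1))%nat with (l + m)%nat by lia; exact H.
      * replace m with (S (m - 1)) at 1 by lia; apply Phi_peel_l; lia.
  - assert (Hi : y x (l + m) = Y l m x) by (symmetry; apply Rmax_right; lra).
    assert (Hl2 : (1 <= l + m <= k)%nat) by (apply (wt_pos_inv k theta x); lra).
    destruct (Rlt_le_dec (y x (l + m)) (y x (l + m - 1))) as [Ha|Ha].
    + apply (Hgood (l + m)%nat); auto; apply xrate_nbr_r; auto; lia.
    + apply (Hbad (l + m)%nat (excess l (m - 1) x)); auto; [lra|].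
      apply excess_peel with (l + m - 1)%nat; auto; try lia; try lra.
      * rewrite <- Hi; unfold nbr; apply Rmax_lub; [lra|].
        replace (l + (m - 1))%nat with (l + m - 1)%nat by lia; exact Ha.
      * replace m with (S (m - 1)) at 1 by lia.
        replace (l + m - 1)%nat with (l + (m - 1))%nat by lia; apply Phi_peel_r; lia.
Qed.

Definition excess_sum (m : nat) (x : nat -> Z) : R :=
  Rsum (fun l => excess l m x) (seq 1 k).

Lemma excess_sum_nonneg m x : (m < k)%nat -> 0 <= excess_sum m x.
Proof.
  intros Hm; apply Rsum_nonneg; intros l Hl; apply in_seq in Hl.
  apply excess_nonneg; lia.
Qed.

(** Each shorter interval arises from at most two longer ones, by dropping a left or a right end. *)
Lemma excess_sum_drift m x :
  (1 <= m < k)%nat ->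
  L (excess_sum m) x <=
  - delta * excess_sum m x + C * (1 + b1) * (INR k + 2 * excess_sum (m - 1) x).
Proof.
  intros Hm.
  assert (Hshift : Rsum (fun l => excess (S l) (m - 1) x) (seq 1 k) <= excess_sum (m - 1) x).
  (* The index shift brings in the left end [k + 1], where the interval is empty or overruns [k]. *)
  { assert (Hlast : excess (k + 1) (m - 1) x = 0).
    { destruct (Nat.eq_dec m 1) as [->|]; [apply excess_0|apply excess_out; lia]. }
    unfold excess_sum; rewrite <- (Rsum_seq_shift (fun l => excess l (m - 1) x)).
    destruct k as [|k'] eqn:Ek; [lia|].
    rewrite Rsum_seq_S.
    change (seq 1 (S k')) with (1%nat :: seq 2 k'); rewrite Rsum_cons.
    replace (2 + k')%nat with (S k' + 1)%nat by lia; rewrite Hlast.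
    assert (0 <= excess 1 (m - 1) x) by (rewrite <- Ek in *; apply excess_nonneg; lia).
    lra. }
  assert (HCb : 0 < C * (1 + b1)) by (apply Rmult_lt_0_compat; lra).
  unfold excess_sum at 1; rewrite gen_Rsum.
  apply Rle_trans with (Rsum (fun l => - delta * excess l m x
     + C * (1 + b1) * (1 + excess l (m - 1) x + excess (S l) (m - 1) x)) (seq 1 k)).
  - apply Rsum_le; intros l Hl; apply in_seq in Hl; apply excess_drift; lia.
  - rewrite Rsum_plus, !Rsum_scal, !Rsum_plus, Rsum_const, length_seq.
    fold (excess_sum m x) (excess_sum (m - 1) x).
    apply Rplus_le_compat_l, Rmult_le_compat_l; lra.
Qed.

(** The drift at length [S m] involves only the lengths [S m] and [m], so the new sum is added with
    a weight [kap] small enough for the negative drift already available to absorb the coupling. *)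
Lemma lyapunov_levels m :
  (m < k)%nat -> exists G eps c D,
    0 < eps /\ 0 < c /\ (forall x, 0 <= G x) /\
    (forall x, L G x <= - eps * G x + D) /\
    (forall x i, (1 <= i <= m)%nat -> c * excess_sum i x <= G x).
Proof.
  induction m as [|m IH]; intros Hm.
  - exists (fun _ => 0), 1, 1, 0; repeat split; try lra; try (intros; lra).
    + intros x; rewrite gen_const; lra.
    + intros; lia.
  - destruct (IH ltac:(lia)) as (G & eps & c & D & Heps & Hc & HG & HD & HF).
    set (K := C * (1 + b1)).
    assert (HK : 0 < K) by (apply Rmult_lt_0_compat; lra).
    (* With this value the coupling is at most [eps / 2 * G x], since
       [c * excess_sum m x <= G x]. *)
    set (kap := eps * c / (4 * K)).
    assert (Hkap : 0 < kap) by (apply Rdiv_lt_0_compat; [apply Rmult_lt_0_compat|]; lra).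
    assert (HkK : kap * (K * 2) = eps * c / 2) by (unfold kap; field; lra).
    exists (fun x => G x + kap * excess_sum (S m) x), (Rmin (eps / 2) delta), (Rmin c kap),
      (D + kap * (K * INR k)).
    assert (Hn : forall x, 0 <= excess_sum (S m) x) by (intros; now apply excess_sum_nonneg).
    assert (Hkn : forall x, 0 <= kap * excess_sum (S m) x)
      by (intros; apply Rmult_le_pos; [lra|auto]).
    split; [|split; [|split; [|split]]].
    + apply Rmin_glb_lt; lra.
    + apply Rmin_glb_lt; lra.
    + intros x; specialize (HG x); specialize (Hkn x); lra.
    + intros x; rewrite gen_plus, gen_scal.
      assert (Hd := excess_sum_drift (S m) x ltac:(lia)); fold K in Hd.
      replace (S m - 1)%nat with m in Hd by lia.
      apply Rmult_le_compat_l with (r := kap) in Hd; [|lra].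
      assert (Hm' : c * excess_sum m x <= G x).
      { destruct m as [|m]; [|apply HF; lia].
        unfold excess_sum; rewrite Rsum_zero by (intros; apply excess_0).
        specialize (HG x); lra. }
      assert (H1 : kap * (K * (2 * excess_sum m x)) <= eps / 2 * G x).
      { replace (kap * (K * (2 * excess_sum m x))) with (eps / 2 * (c * excess_sum m x))
          by (replace (kap * (K * (2 * excess_sum m x)))
                with (kap * (K * 2) * excess_sum m x) by ring; rewrite HkK; field).
        apply Rmult_le_compat_l; lra. }
      specialize (HD x); specialize (HG x); specialize (Hkn x).
      assert (Rmin (eps / 2) delta * G x <= eps / 2 * G x)
        by (apply Rmult_le_compat_r; [lra|apply Rmin_l]).
      assert (Rmin (eps / 2) delta * (kap * excess_sum (S m) x)
              <= delta * (kap * excess_sum (S m) x))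
        by (apply Rmult_le_compat_r; [lra|apply Rmin_r]).
      lra.
    + intros x i Hi.
      assert (Hi0 : 0 <= excess_sum i x) by (apply excess_sum_nonneg; lia).
      destruct (Nat.eq_dec i (S m)) as [->|Hne].
      * specialize (HG x).
        assert (Rmin c kap * excess_sum (S m) x <= kap * excess_sum (S m) x)
          by (apply Rmult_le_compat_r; [lra|apply Rmin_r]); lra.
      * specialize (HF x i ltac:(lia)); specialize (Hkn x).
        assert (Rmin c kap * excess_sum i x <= c * excess_sum i x)
          by (apply Rmult_le_compat_r; [lra|apply Rmin_l]); lra.
Qed.

(* Starting from the highest site, an interval of sites that are not too low can
   always be extended by one of its neighbours, until it is {1, ..., k}. *)
Lemma excess_bounded_gap M x :
  1 <= M ->
  (forall l m, (1 <= l)%nat -> (1 <= m < k)%nat -> (l + m <= k + 1)%nat -> excess l m x <= M) ->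
  forall i j, (1 <= i <= k)%nat -> (1 <= j <= k)%nat -> y x i <= M ^ (k - 1) * y x j.
Proof.
  intros HM HQ.
  destruct (finite_argmax (y x) 1 k ltac:(lia)) as (p & Hp & Hmax).
  assert (Hind : forall m, (1 <= m <= k)%nat -> exists l, (1 <= l)%nat /\ (l + m <= k + 1)%nat /\
            forall j, (l <= j < l + m)%nat -> y x p <= M ^ (m - 1) * y x j).
  { induction m as [|m IH]; intros Hm; [lia|].
    destruct (Nat.eq_dec m 0) as [->|Hm0].
    - exists p; repeat split; try lia; intros j Hj; replace j with p by lia; simpl; lra.
    - destruct (IH ltac:(lia)) as (l & Hl & Hlm & Hj).
      assert (HMm : 0 < M ^ (m - 1)) by (apply pow_lt; lra).
      (* All weights of the interval are at least this quotient, hence so is the potential; the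
         ratio bound then passes it on to the higher neighbour at the cost of one more factor
         [M]. *)
      assert (Hphi : y x p / M ^ (m - 1) <= Phi l m x).
      { apply Phi_ge; try lia; intros j Hj'.
        apply Rmult_le_reg_l with (M ^ (m - 1)); auto.
        replace (M ^ (m - 1) * (y x p / M ^ (m - 1))) with (y x p) by (field; lra).
        now apply Hj. }
      assert (HN := nbr_pos k theta l m x Hl Hlm ltac:(lia)).
      specialize (HQ l m Hl ltac:(lia) Hlm); rewrite excess_in in HQ by exact Hlm.
      apply Rmult_le_compat_r with (r := Y l m x) in HQ; [|lra].
      unfold Rdiv in HQ; rewrite Rmult_assoc, Rinv_l, Rmult_1_r in HQ by lra.
      assert (Hn : y x p <= M ^ m * Y l m x).
      { replace m with (S (m - 1)) at 1 by lia; simpl pow.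
        assert (H := Rle_trans _ _ _ Hphi HQ).
        apply Rmult_le_compat_l with (r := M ^ (m - 1)) in H; [|lra].
        replace (M ^ (m - 1) * (y x p / M ^ (m - 1))) with (y x p) in H by (field; lra).
        lra. }
      assert (Hext : forall j, (l <= j < l + m)%nat -> y x p <= M ^ m * y x j).
      { intros j Hj'; apply Rle_trans with (1 := Hj j Hj').
        apply Rmult_le_compat_r; [apply wt_nonneg|apply Rle_pow; [lra|lia]]. }
      replace (S m - 1)%nat with m by lia.
      destruct (Rle_lt_dec (y x (l + m)) (y x (l - 1))) as [H|H].
      + assert (Hi : Y l m x = y x (l - 1)) by (apply Rmax_left, H).
        assert (Hr : (1 <= l - 1 <= k)%nat) by (apply (wt_pos_inv k theta x); lra).
        exists (l - 1)%nat; repeat split; try lia; intros j Hj'.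
        destruct (Nat.eq_dec j (l - 1)) as [->|]; [rewrite <- Hi; exact Hn|].
        apply Hext; lia.
      + assert (Hi : Y l m x = y x (l + m)) by (apply Rmax_right; lra).
        assert (Hr : (1 <= l + m <= k)%nat) by (apply (wt_pos_inv k theta x); lra).
        exists l; repeat split; try lia; intros j Hj'.
        destruct (Nat.eq_dec j (l + m)) as [->|]; [rewrite <- Hi; exact Hn|].
        apply Hext; lia. }
  intros i j Hi Hj; destruct (Hind k ltac:(lia)) as (l & Hl & Hlk & H).
  apply Rle_trans with (1 := Hmax i ltac:(lia)); apply H; lia.
Qed.

(** A bound on the Lyapunov function bounds every interval ratio, hence all ratios of weights and,
    by logarithms, all height differences: this is the coercivity that [foster] needs. *)
Theorem ergodic_of_interval_potential : shape_ergodic k b0 b1 b2.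
Proof.
  destruct (lyapunov_levels (k - 1) ltac:(lia)) as (G & eps & c & D & Heps & Hc & HG & HD & HF).
  apply foster with G eps D; auto; try lia.
  intros M; set (M' := Rmax 1 (M / c)).
  assert (HM' : 1 <= M') by apply Rmax_l.
  exists (up (ln (M' ^ (k - 1)) / theta)); intros x Hx i Hi.
  assert (HQ : forall l m, (1 <= l)%nat -> (1 <= m < k)%nat -> (l + m <= k + 1)%nat ->
            excess l m x <= M').
  { intros l m Hl Hm Hlm; apply Rle_trans with (M / c); [|apply Rmax_r].
    apply Rle_trans with (excess_sum m x).
    - apply (Rsum_ge_term (fun l => excess l m x)); [|apply in_seq; lia].
      intros l' Hl'; apply in_seq in Hl'; apply excess_nonneg; lia.
    - specialize (HF x m ltac:(lia)); apply Rmult_le_reg_l with c; auto.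
      replace (c * (M / c)) with M by (field; lra); lra. }
  assert (Hpow : 0 < M' ^ (k - 1)) by (apply pow_lt; lra).
  assert (Hgap : forall i j, (1 <= i <= k)%nat -> (1 <= j <= k)%nat ->
            IZR (x i) - IZR (x j) <= ln (M' ^ (k - 1)) / theta).
  { intros i' j' Hi' Hj'.
    assert (H := excess_bounded_gap M' x HM' HQ i' j' Hi' Hj').
    rewrite !wt_in in H by assumption.
    rewrite <- (exp_ln (M' ^ (k - 1))), <- exp_plus in H by exact Hpow.
    assert (H' : theta * IZR (x i') <= ln (M' ^ (k - 1)) + theta * IZR (x j')).
    { destruct H as [H|H]; [apply Rlt_le, exp_lt_inv, H|].
      apply exp_inv in H; lra. }
    apply Rmult_le_reg_l with theta; auto.
    replace (theta * (ln (M' ^ (k - 1)) / theta)) with (ln (M' ^ (k - 1))) by (field; lra).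
    lra. }
  destruct (archimed (ln (M' ^ (k - 1)) / theta)) as [Hup _].
  assert (H1 := Hgap i (S i) ltac:(lia) ltac:(lia)).
  assert (H2 := Hgap (S i) i ltac:(lia) ltac:(lia)).
  apply Z.abs_le; split; apply le_IZR; rewrite ?opp_IZR, minus_IZR; lra.
Qed.

End Lyapunov.

(** * Maximum and geometric mean *)

Section Potentials.

Variables (k : nat) (b0 b1 b2 theta : R).
Hypotheses (h0 : 0 < b0) (h02 : b0 < b2) (h21 : b2 < b1)
  (htheta : 0 < theta).

Local Notation y := (wt k theta).
Local Notation Y := (nbr k theta).
Local Notation r := (xrate k b0 b1 b2).
Local Notation L := (gen k b0 b1 b2).

Lemma xrate_local_max x j :
  (1 <= j <= k)%nat -> y x (j - 1) <= y x j -> y x (S j) <= y x j -> r x j = b0.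
Proof.
  intros Hj Hl Hr; unfold xrate, Vx.
  destruct (Nat.leb_spec 2 j), (Nat.leb_spec j (k - 1)),
    (Z.ltb_spec (x j) (x (j - 1)%nat)), (Z.ltb_spec (x j) (x (S j))); try reflexivity;
    exfalso;
    first [assert (y x j < y x (j - 1)) by (apply wt_lt_mono; auto; lia); lra
          |assert (y x j < y x (S j)) by (apply wt_lt_mono; auto; lia); lra].
Qed.

Lemma xrate_interval_max l m x p :
  (1 <= l)%nat -> (l + m <= k + 1)%nat -> (l <= p < l + m)%nat ->
  (forall i, (l <= i < l + m)%nat -> y x i <= y x p) -> Y l m x <= y x p -> r x p = b0.
Proof.
  intros Hl Hlm Hp Hmax HY; apply xrate_local_max; [lia| |].
  - destruct (Nat.eq_dec p l) as [->|]; [|apply Hmax; lia].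
    apply Rle_trans with (2 := HY), Rmax_l.
  - destruct (Nat.eq_dec (S p) (l + m)) as [->|]; [|apply Hmax; lia].
    apply Rle_trans with (2 := HY), Rmax_r.
Qed.

Lemma gen_local (F : (nat -> Z) -> R) l m x :
  (1 <= l)%nat -> (l + m <= k + 1)%nat ->
  (forall j, ~ (l <= j < l + m)%nat -> F (bump x j) = F x) ->
  L F x = Rsum (fun j => r x j * (F (bump x j) - F x)) (seq l m).
Proof.
  intros Hl Hlm HF; unfold gen.
  assert (E : seq 1 k = seq 1 (l - 1) ++ seq l m ++ seq (l + m) (k + 1 - (l + m))).
  { rewrite <- seq_app.
    replace (seq l (m + (k + 1 - (l + m)))) with (seq (1 + (l - 1)) (m + (k + 1 - (l + m))))
      by (f_equal; lia).
    rewrite <- seq_app; f_equal; lia. }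
  rewrite E, !Rsum_app.
  rewrite (Rsum_zero _ (seq 1 _)), (Rsum_zero _ (seq (l + m) _)); [ring| |];
    intros j Hj; apply in_seq in Hj; rewrite HF by lia; ring.
Qed.

Definition hull_max (l m : nat) (x : nat -> Z) : R := fold_right Rmax 0 (map (y x) (seq l m)).

Lemma hull_max_ge l m x j : (l <= j < l + m)%nat -> y x j <= hull_max l m x.
Proof.
  unfold hull_max; intros Hj; assert (Hi : In j (seq l m)) by (apply in_seq; lia).
  induction (seq l m) as [|i s IH]; [destruct Hi|]; simpl.
  destruct Hi as [->|Hi]; [apply Rmax_l|].
  apply Rle_trans with (1 := IH Hi), Rmax_r.
Qed.

Lemma hull_max_lub l m x t :
  0 <= t -> (forall j, (l <= j < l + m)%nat -> y x j <= t) -> hull_max l m x <= t.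
Proof.
  unfold hull_max; intros Ht H.
  assert (H' : forall j, In j (seq l m) -> y x j <= t) by (intros j Hj; apply in_seq in Hj; auto).
  induction (seq l m) as [|i s IH]; simpl; [exact Ht|].
  apply Rmax_lub; [apply H'; now left|apply IH; intros; apply H'; now right].
Qed.

Lemma hull_max_nonneg l m x : 0 <= hull_max l m x.
Proof.
  unfold hull_max; induction (seq l m) as [|i s IH]; simpl; [lra|].
  apply Rle_trans with (1 := IH), Rmax_r.
Qed.

Lemma hull_max_local l m x j :
  ~ (l <= j < l + m)%nat -> hull_max l m (bump x j) = hull_max l m x.
Proof.
  intros Hj; unfold hull_max; f_equal; apply map_ext_in; intros i Hi; apply in_seq in Hi.
  apply wt_bump_neq; lia.
Qed.

Lemma hull_max_peel_r l m x : hull_max l (S m) x <= hull_max l m x + y x (l + m).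
Proof.
  assert (H0 := hull_max_nonneg l m x); assert (H1 := wt_nonneg k theta x (l + m)).
  apply hull_max_lub; [lra|]; intros j Hj.
  destruct (Nat.eq_dec j (l + m)) as [->|]; [lra|].
  assert (H := hull_max_ge l m x j ltac:(lia)); lra.
Qed.

Lemma hull_max_peel_l l m x : hull_max l (S m) x <= hull_max (S l) m x + y x l.
Proof.
  assert (H0 := hull_max_nonneg (S l) m x); assert (H1 := wt_nonneg k theta x l).
  apply hull_max_lub; [lra|]; intros j Hj.
  destruct (Nat.eq_dec j l) as [->|]; [lra|].
  assert (H := hull_max_ge (S l) m x j ltac:(lia)); lra.
Qed.

(** A jump strictly below the maximum does not raise it. A site attaining it has rate [b0] if it
    dominates both neighbours of the interval; otherwise its gain is absorbed by [Y]. At most [m]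
    sites attain the maximum. *)
Lemma hull_max_drift l m x :
  (1 <= l)%nat -> (1 <= m)%nat -> (l + m <= k + 1)%nat ->
  L (hull_max l m) x <=
  (exp theta - 1) * (INR m * b0) * hull_max l m x + INR k * b1 * (exp theta - 1) * Y l m x.
Proof.
  intros Hl Hm Hlm.
  assert (Ha := exp_theta_gt_1 theta htheta).
  rewrite (gen_local _ l m) by (auto; intros; now apply hull_max_local).
  destruct (finite_argmax (y x) l m Hm) as (p & Hp & Hmax).
  assert (Hpe : hull_max l m x = y x p).
  { apply Rle_antisym; [|now apply hull_max_ge].
    apply hull_max_lub; auto; apply wt_nonneg. }
  assert (HY : 0 <= Y l m x) by (apply Rle_trans with (2 := Rmax_l _ _), wt_nonneg).
  assert (Hy := wt_nonneg k theta x p).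
  assert (Hbound : 0 <= b1 * (exp theta - 1) * Y l m x).
  { repeat apply Rmult_le_pos; lra. }
  assert (Hbound' : 0 <= b0 * (exp theta - 1) * y x p).
  { repeat apply Rmult_le_pos; lra. }
  apply Rle_trans with (Rsum (fun _ => b0 * (exp theta - 1) * hull_max l m x
                                       + b1 * (exp theta - 1) * Y l m x) (seq l m)).
  - apply Rsum_le; intros j Hj; apply in_seq in Hj.
    assert (Hr := xrate_pos k b0 b1 b2 h0 h02 h21 x j).
    assert (Hr1 := xrate_le k b0 b1 b2 h02 h21 x j).
    rewrite Hpe.
    destruct (Hmax j Hj) as [Hlt|Heq].
    + assert (hull_max l m (bump x j) <= y x p).
      { apply hull_max_lub; auto; intros i Hi; destruct (Nat.eq_dec i j) as [->|Hij].
        - rewrite wt_bump_eq; now apply wt_lt_step.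
        - rewrite wt_bump_neq by exact Hij; auto. }
      assert (r x j * (hull_max l m (bump x j) - y x p) <= 0) by nra.
      lra.
    + assert (Hb : hull_max l m (bump x j) - y x p <= (exp theta - 1) * y x p).
      { assert (hull_max l m (bump x j) <= exp theta * y x p); [|lra].
        apply hull_max_lub; [apply Rmult_le_pos; lra|].
        intros i Hi; destruct (Nat.eq_dec i j) as [->|Hij].
        - rewrite wt_bump_eq, Heq; lra.
        - rewrite wt_bump_neq by exact Hij; specialize (Hmax i Hi); nra. }
      apply Rmult_le_compat_l with (r := r x j) in Hb; [|lra].
      assert (Hy1 : 0 <= (exp theta - 1) * y x p) by (apply Rmult_le_pos; lra).
      destruct (Rle_lt_dec (Y l m x) (y x p)) as [HYp|HYp].
      * assert (Hrj : r x j = b0).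
        { apply xrate_interval_max with l m; auto; rewrite Heq; auto. }
        rewrite Hrj in *; lra.
      * assert (r x j * ((exp theta - 1) * y x p) <= b1 * ((exp theta - 1) * Y l m x)).
        { apply Rmult_le_compat; try lra; apply Rmult_le_compat_l; lra. }
        lra.
  - rewrite Rsum_const, length_seq.
    assert (INR m <= INR k) by (apply le_INR; lia).
    assert (INR m * (b1 * (exp theta - 1) * Y l m x) <= INR k * (b1 * (exp theta - 1) * Y l m x))
      by (apply Rmult_le_compat_r; lra).
    lra.
Qed.

(** Geometric mean of the weights, written through the mean height. The value 0 on the empty
    interval is what [Phi_0] asks. *)
Definition geo_mean (l m : nat) (x : nat -> Z) : R :=
  match m with
  | O => 0
  | _ => exp (theta * (Rsum (fun j => IZR (x j)) (seq l m) / INR m))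
  end.

Lemma geo_mean_S l m x :
  geo_mean l (S m) x = exp (theta * (Rsum (fun j => IZR (x j)) (seq l (S m)) / INR (S m))).
Proof. reflexivity. Qed.

Lemma geo_mean_nonneg l m x : 0 <= geo_mean l m x.
Proof. destruct m; [apply Rle_refl|apply Rlt_le, exp_pos]. Qed.

Lemma geo_mean_local l m x j :
  ~ (l <= j < l + m)%nat -> geo_mean l m (bump x j) = geo_mean l m x.
Proof.
  intros Hj; destruct m as [|m]; [reflexivity|]; rewrite !geo_mean_S.
  rewrite (Rsum_ext_in (fun i => IZR (bump x j i)) (fun i => IZR (x i))); [reflexivity|].
  intros i Hi; apply in_seq in Hi; unfold bump; destruct (Nat.eqb_spec i j); [lia|reflexivity].
Qed.

Lemma geo_mean_bump l m x j :
  (l <= j < l + m)%nat ->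
  geo_mean l m (bump x j) = exp (theta / INR m) * geo_mean l m x.
Proof.
  intros Hj; destruct m as [|m]; [lia|]; rewrite !geo_mean_S, <- exp_plus; f_equal.
  replace (Rsum (fun i => IZR (bump x j i)) (seq l (S m))) with
    (Rsum (fun i => IZR (x i)) (seq l (S m)) + 1).
  - field; apply not_0_INR; lia.
  - rewrite (Rsum_ext_in (fun i => IZR (bump x j i))
               (fun i => IZR (x i) + (if (i =? j)%nat then 1 else 0))).
    + rewrite Rsum_plus, (Rsum_single (fun i => if (i =? j)%nat then 1 else 0) _ j).
      * now rewrite Nat.eqb_refl.
      * apply seq_NoDup.
      * apply in_seq; lia.
      * intros i _ Hi; destruct (Nat.eqb_spec i j); [contradiction|reflexivity].
    + intros i _; unfold bump; destruct (i =? j)%nat; [apply plus_IZR|lra].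
Qed.

(** Averaging in one more number [b] gives a mean between the old one and [b]; its exponential is at
    most the larger of the two, hence at most their sum. *)
Lemma exp_mean_le m A b :
  exp (theta * ((A + b) / INR (S (S m)))) <=
  exp (theta * (A / INR (S m))) + exp (theta * b).
Proof.
  assert (Hm : 0 < INR (S m)) by (apply lt_0_INR; lia).
  assert (HA : A = INR (S m) * (A / INR (S m))) by (field; lra).
  set (a := A / INR (S m)) in *.
  replace ((A + b) / INR (S (S m))) with (a + (b - a) / INR (S (S m)))
    by (rewrite HA, (S_INR (S m)); field; lra).
  assert (Hi : 0 < / INR (S (S m)) <= 1).
  { split; [apply Rinv_0_lt_compat, lt_0_INR; lia|].
    rewrite <- Rinv_1; apply Rinv_le_contravar; [lra|].
    rewrite S_INR; lra. }
  assert (Ha := exp_pos (theta * a)); assert (Hb := exp_pos (theta * b)).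
  unfold Rdiv; destruct (Rle_lt_dec a b) as [H|H].
  - assert (exp (theta * (a + (b - a) * / INR (S (S m)))) <= exp (theta * b)); [|lra].
    destruct (Rle_lt_or_eq_dec (theta * (a + (b - a) * / INR (S (S m)))) (theta * b)) as [E|E].
    + apply Rmult_le_compat_l; [lra|]; nra.
    + now apply Rlt_le, exp_increasing.
    + rewrite E; lra.
  - assert (exp (theta * (a + (b - a) * / INR (S (S m)))) < exp (theta * a)); [|lra].
    apply exp_increasing, Rmult_lt_compat_l; [lra|]; nra.
Qed.

Lemma geo_mean_peel_r l m x :
  (1 <= l)%nat -> (l + S m <= k + 1)%nat ->
  geo_mean l (S m) x <= geo_mean l m x + y x (l + m).
Proof.
  intros Hl Hm; rewrite geo_mean_S, Rsum_seq_S, wt_in by lia; destruct m as [|m].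
  - unfold Rsum; simpl; apply Req_le; rewrite !Rplus_0_l, ?Rplus_0_r, Rdiv_1_r; reflexivity.
  - rewrite geo_mean_S; apply exp_mean_le.
Qed.

Lemma geo_mean_peel_l l m x :
  (1 <= l)%nat -> (l + S m <= k + 1)%nat ->
  geo_mean l (S m) x <= geo_mean (S l) m x + y x l.
Proof.
  intros Hl Hm; rewrite geo_mean_S, wt_in by lia.
  change (seq l (S m)) with (l :: seq (S l) m); rewrite Rsum_cons; destruct m as [|m].
  - unfold Rsum; simpl; apply Req_le; rewrite !Rplus_0_l, ?Rplus_0_r, Rdiv_1_r; reflexivity.
  - rewrite geo_mean_S, (Rplus_comm (IZR (x l))); apply exp_mean_le.
Qed.

Lemma mean_bounds (f : nat -> R) l m a b :
  (1 <= m)%nat -> (forall j, (l <= j < l + m)%nat -> a <= f j <= b) ->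
  a <= Rsum f (seq l m) / INR m <= b.
Proof.
  intros Hm H; assert (Hm' : 0 < INR m) by (apply lt_0_INR; lia).
  assert (Hc : forall c, Rsum (fun _ => c) (seq l m) = INR m * c)
    by (intros; rewrite Rsum_const, length_seq; reflexivity).
  assert (H1 : Rsum (fun _ => a) (seq l m) <= Rsum f (seq l m))
    by (apply Rsum_le; intros j Hj; apply in_seq in Hj; now apply H).
  assert (H2 : Rsum f (seq l m) <= Rsum (fun _ => b) (seq l m))
    by (apply Rsum_le; intros j Hj; apply in_seq in Hj; now apply H).
  rewrite Hc in H1, H2.
  split; apply Rmult_le_reg_l with (INR m); auto;
    replace (INR m * (Rsum f (seq l m) / INR m)) with (Rsum f (seq l m)) by (field; lra); lra.
Qed.

Lemma exp_le_mono a b : a <= b -> exp a <= exp b.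
Proof. intros [H| ->]; [apply Rlt_le, exp_increasing, H|apply Rle_refl]. Qed.

Lemma geo_mean_bounds l m x p q :
  (1 <= l)%nat -> (l + m <= k + 1)%nat -> (l <= p < l + m)%nat -> (l <= q < l + m)%nat ->
  (forall i, (l <= i < l + m)%nat -> y x q <= y x i <= y x p) ->
  y x q <= geo_mean l m x <= y x p.
Proof.
  intros Hl Hm Hp Hq H; destruct m as [|m]; [lia|].
  assert (Hi : forall i, (l <= i < l + S m)%nat -> IZR (x q) <= IZR (x i) <= IZR (x p)).
  { intros i Hi; specialize (H i Hi).
    split; apply IZR_le.
    - destruct (Z.le_gt_cases (x q) (x i)) as [|Hlt]; [assumption|].
      assert (y x i < y x q) by (apply wt_lt_mono; auto; lia); lra.
    - destruct (Z.le_gt_cases (x i) (x p)) as [|Hlt]; [assumption|].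
      assert (y x p < y x i) by (apply wt_lt_mono; auto; lia); lra. }
  destruct (mean_bounds _ l (S m) _ _ ltac:(lia) Hi).
  rewrite geo_mean_S, !wt_in by lia.
  split; apply exp_le_mono, Rmult_le_compat_l; lra.
Qed.

Lemma geo_mean_le_hull_max l m x :
  (1 <= l)%nat -> (l + m <= k + 1)%nat -> geo_mean l m x <= hull_max l m x.
Proof.
  intros Hl Hm; destruct m as [|m]; [apply hull_max_nonneg|].
  destruct (finite_argmax (y x) l (S m) ltac:(lia)) as (p & Hp & Hmax).
  destruct (finite_argmax (fun i => - y x i) l (S m) ltac:(lia)) as (q & Hq & Hmin).
  apply Rle_trans with (y x p); [|now apply hull_max_ge].
  apply (geo_mean_bounds l (S m) x p q); auto.
  intros i Hi; specialize (Hmax i Hi); specialize (Hmin i Hi); lra.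
Qed.

Lemma exp_pow n t : exp (INR n * t) = exp t ^ n.
Proof.
  induction n as [|n IH]; [simpl; rewrite Rmult_0_l; apply exp_0|].
  rewrite S_INR, Rmult_plus_distr_r, exp_plus, IH, Rmult_1_l; simpl; ring.
Qed.

(** Bernoulli's inequality, which is [poly], applied to [exp (theta / INR m)], whose power [m] is
    [exp theta]. *)
Lemma exp_div_bernoulli m :
  (1 <= m)%nat -> 0 < exp (theta / INR m) - 1 <= (exp theta - 1) / INR m.
Proof.
  intros Hm; assert (Hm' : 0 < INR m) by (apply lt_0_INR; lia).
  assert (Hpos : 0 < exp (theta / INR m) - 1).
  { assert (Ht : 0 < theta / INR m) by now apply Rdiv_lt_0_compat.
    apply exp_increasing in Ht; rewrite exp_0 in Ht; lra. }
  split; [exact Hpos|].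
  assert (H := poly m _ Hpos).
  replace (1 + (exp (theta / INR m) - 1)) with (exp (theta / INR m)) in H by ring.
  rewrite <- exp_pow in H; replace (INR m * (theta / INR m)) with theta in H by (field; lra).
  apply Rmult_le_reg_l with (INR m); auto.
  replace (INR m * ((exp theta - 1) / INR m)) with (exp theta - 1) by (field; lra); lra.
Qed.

(** Every jump in the interval multiplies the mean by the same factor, so only the sum of the rates
    counts. If the highest site dominates the neighbours of the interval, its rate is [b0];
    otherwise the mean itself is at most [Y]. *)
Lemma geo_mean_drift l m x :
  (1 <= l)%nat -> (1 <= m)%nat -> (l + m <= k + 1)%nat ->
  L (geo_mean l m) x <=
  (exp theta - 1) * (((INR m - 1) * b1 + b0) / INR m) * geo_mean l m x
  + INR k * b1 * (exp theta - 1) * Y l m x.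
Proof.
  intros Hl Hm Hlm.
  assert (Ha := exp_theta_gt_1 theta htheta).
  assert (Hm' : 1 <= INR m) by (apply (le_INR 1); lia).
  assert (Hmk : INR m <= INR k) by (apply le_INR; lia).
  destruct (exp_div_bernoulli m Hm) as [He0 He].
  assert (HG := geo_mean_nonneg l m x).
  assert (HY : 0 <= Y l m x) by (apply Rle_trans with (2 := Rmax_l _ _), wt_nonneg).
  rewrite (gen_local _ l m) by (auto; intros; now apply geo_mean_local).
  rewrite (Rsum_ext_in _ (fun j => (exp (theta / INR m) - 1) * geo_mean l m x * r x j))
    by (intros j Hj; apply in_seq in Hj; rewrite geo_mean_bump by exact Hj; ring).
  rewrite Rsum_scal.
  destruct (finite_argmax (y x) l m Hm) as (p & Hp & Hmax).
  assert (Hr : Rsum (r x) (seq l m) <= INR m * b1 - (b1 - r x p)).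
  { assert (H : b1 - r x p <= Rsum (fun j => b1 - r x j) (seq l m)).
    { apply (Rsum_ge_term (fun j => b1 - r x j)); [|apply in_seq; lia].
      intros j _; assert (H := xrate_le k b0 b1 b2 h02 h21 x j); lra. }
    rewrite (Rsum_ext_in _ (fun j => b1 + (-1) * r x j)) in H by (intros; ring).
    rewrite Rsum_plus, Rsum_const, Rsum_scal, length_seq in H; lra. }
  assert (HK : 0 <= INR k * b1 * (exp theta - 1) * Y l m x)
    by (repeat apply Rmult_le_pos; lra).
  set (e := exp (theta / INR m) - 1) in *.
  assert (Hem : e * INR m <= exp theta - 1).
  { apply Rmult_le_compat_r with (r := INR m) in He; [|lra].
    replace ((exp theta - 1) / INR m * INR m) with (exp theta - 1) in He by (field; lra); lra. }
  assert (HeG : 0 <= e * geo_mean l m x) by (apply Rmult_le_pos; lra).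
  destruct (Rle_lt_dec (Y l m x) (y x p)) as [HYp|HYp].
  - rewrite (xrate_interval_max l m x p) in Hr by auto.
    apply Rle_trans with (e * geo_mean l m x * ((INR m - 1) * b1 + b0));
      [apply Rmult_le_compat_l; lra|].
    assert (Hv : 0 <= (INR m - 1) * b1 + b0) by nra.
    assert (e * geo_mean l m x * ((INR m - 1) * b1 + b0) <=
            (exp theta - 1) / INR m * (geo_mean l m x * ((INR m - 1) * b1 + b0))).
    { rewrite Rmult_assoc; apply Rmult_le_compat_r; [apply Rmult_le_pos|]; lra. }
    unfold Rdiv in *; lra.
  - assert (Hgp : geo_mean l m x <= Y l m x).
    { apply Rle_trans with (1 := geo_mean_le_hull_max l m x Hl Hlm).
      apply hull_max_lub; [lra|]; intros j Hj; specialize (Hmax j Hj); lra. }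
    assert (Hrp := xrate_le k b0 b1 b2 h02 h21 x p).
    apply Rle_trans with (e * geo_mean l m x * (INR m * b1));
      [apply Rmult_le_compat_l; lra|].
    assert (H1 : e * INR m * (b1 * geo_mean l m x) <= (exp theta - 1) * (b1 * Y l m x)).
    { apply Rmult_le_compat; try lra; try (apply Rmult_le_pos; lra).
      apply Rmult_le_compat_l; lra. }
    assert (H2 : (exp theta - 1) * (b1 * Y l m x) <= INR k * ((exp theta - 1) * (b1 * Y l m x))).
    { assert (0 <= (exp theta - 1) * (b1 * Y l m x)) by (repeat apply Rmult_le_pos; lra).
      nra. }
    assert (0 <= (exp theta - 1) * (((INR m - 1) * b1 + b0) / INR m) * geo_mean l m x).
    { unfold Rdiv; repeat apply Rmult_le_pos; try lra; [nra|].
      apply Rlt_le, Rinv_0_lt_compat; lra. }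
    lra.
Qed.

End Potentials.

(** * Block speeds *)

Lemma finite_pos_min (f : nat -> R) n :
  (forall m, (1 <= m <= n)%nat -> 0 < f m) ->
  exists d, 0 < d /\ forall m, (1 <= m <= n)%nat -> d <= f m.
Proof.
  induction n as [|n IH]; intros Hf; [exists 1; split; [lra|intros; lia]|].
  destruct IH as (d & Hd & H); [intros; apply Hf; lia|].
  exists (Rmin d (f (S n))); split; [apply Rmin_glb_lt; auto; apply Hf; lia|].
  intros m Hm; destruct (Nat.eq_dec m (S n)) as [->|]; [apply Rmin_r|].
  apply Rle_trans with d; [apply Rmin_l|apply H; lia].
Qed.

(* [m0] is the length from which the geometric mean is used instead of the
   maximum.  Under (a) it is [k - 1]: an interval of that length has a boundary
   site as its only neighbour, which moves at rate [b1] when lower, while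
   [(k - 1) * b0] may exceed [b1]. *)
Definition block_speed (b0 b1 : R) (m0 m : nat) : R :=
  if (m0 <=? m)%nat then ((INR m - 1) * b1 + b0) / INR m else INR m * b0.

(** For small [theta], [exp theta - 1] and [1 - exp (- theta)] agree to first order, so a strict
    comparison of speeds survives with a margin. *)
Theorem ergodic_of_block_speed (k : nat) (b0 b1 b2 : R) (m0 : nat) :
  (2 <= k)%nat -> 0 < b0 -> b0 < b2 -> b2 < b1 ->
  (forall m, (1 <= m < k)%nat -> block_speed b0 b1 m0 m < nbr_rate k b1 b2 m) ->
  shape_ergodic k b0 b1 b2.
Proof.
  intros hk h0 h02 h21 Hv.
  destruct (finite_pos_min (fun m => nbr_rate k b1 b2 m - block_speed b0 b1 m0 m) (k - 1))
    as (d & Hd & Hgap).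
  { intros m Hm; specialize (Hv m ltac:(lia)); lra. }
  (* [a] is to be [exp theta]. Speeds are below [b1], so passing from a speed [v] to [a * v] uses up
     at most half of the gap [d]. *)
  set (a := 1 + d / (2 * b1)).
  assert (Ha : 1 < a) by
    (unfold a; assert (0 < d / (2 * b1)) by (apply Rdiv_lt_0_compat; lra); lra).
  set (theta := ln a).
  assert (Hth : 0 < theta) by (unfold theta; rewrite <- ln_1; apply ln_increasing; lra).
  assert (Hea : exp theta = a) by (apply exp_ln; lra).
  (* [1 - exp (- theta)] equals [(a - 1) * / a]; it multiplies the other half of the gap. *)
  set (delta := (a - 1) * / a * (d / 2)).
  assert (Hia : 0 < / a) by (apply Rinv_0_lt_compat; lra).
  assert (Hdelta : 0 < delta) by (unfold delta; repeat apply Rmult_lt_0_compat; lra).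
  set (C := 1 + INR k * b1 * (a - 1)).
  assert (HC : 1 <= C).
  { assert (0 <= INR k * b1 * (a - 1))
      by (repeat apply Rmult_le_pos; try apply pos_INR; lra).
    unfold C; lra. }
  assert (Hspeed : forall m, (1 <= m < k)%nat ->
            (a - 1) * block_speed b0 b1 m0 m <=
            (1 - exp (- theta)) * nbr_rate k b1 b2 m - delta).
  { intros m Hm; rewrite exp_Ropp, Hea.
    specialize (Hgap m ltac:(lia)); simpl in Hgap.
    assert (Hr := nbr_rate_le k b1 b2 h21 m).
    set (v := block_speed b0 b1 m0 m) in *; set (q := nbr_rate k b1 b2 m) in *.
    assert (Hav : a * v <= q - d / 2).
    { unfold a; rewrite Rmult_plus_distr_r, Rmult_1_l.
      assert (d / (2 * b1) * v <= d / (2 * b1) * b1).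
      { apply Rmult_le_compat_l; [|lra]; apply Rlt_le, Rdiv_lt_0_compat; lra. }
      replace (d / (2 * b1) * b1) with (d / 2) in H by (field; lra); lra. }
    assert (H : (a - 1) * / a * (a * v) <= (a - 1) * / a * (q - d / 2)).
    { apply Rmult_le_compat_l; [apply Rmult_le_pos|]; lra. }
    replace ((a - 1) * / a * (a * v)) with ((a - 1) * v) in H by (field; lra).
    unfold delta; replace (1 - / a) with ((a - 1) * / a) by (field; lra); lra. }
  set (Phi := fun l m x => if (m0 <=? m)%nat then geo_mean theta l m x else hull_max k theta l m x).
  assert (Hgeo := geo_mean_nonneg theta).
  assert (Hhull := hull_max_nonneg k theta).
  assert (Hwt := wt_nonneg k theta).
  assert (HCle : forall t, 0 <= t -> t <= C * t) by (intros; nra).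
  apply ergodic_of_interval_potential with theta delta C Phi; auto; try lra.
  - intros l x; unfold Phi; destruct (_ <=? _)%nat; reflexivity.
  - intros l m x; unfold Phi; destruct (_ <=? _)%nat; auto.
  - intros l m x j Hj; unfold Phi; destruct (_ <=? _)%nat;
      [now apply geo_mean_local|now apply hull_max_local].
  - intros l m x Hl Hm Hlm; specialize (Hspeed m Hm).
    assert (HY := nbr_pos k theta l m x Hl Hlm ltac:(lia)).
    assert (H : gen k b0 b1 b2 (Phi l m) x <=
              (a - 1) * block_speed b0 b1 m0 m * Phi l m x
              + INR k * b1 * (a - 1) * nbr k theta l m x).
    { unfold Phi, block_speed; rewrite <- Hea; destruct (_ <=? _)%nat.
      - apply geo_mean_drift; auto; lia.
      - apply hull_max_drift; auto; lia. }
    apply Rle_trans with (1 := H); apply Rplus_le_compat.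
    + apply Rmult_le_compat_r; [|exact Hspeed].
      unfold Phi; destruct (_ <=? _)%nat; auto.
    + apply Rmult_le_compat_r; unfold C; lra.
  - intros l m x Hl Hm.
    apply Rle_trans with (Phi l m x + wt k theta x (l + m));
      [|apply HCle; unfold Phi; specialize (Hwt x (l + m)%nat);
        destruct (m0 <=? m)%nat; apply Rplus_le_le_0_compat; auto].
    unfold Phi; destruct (Nat.leb_spec m0 (S m)), (Nat.leb_spec m0 m); try lia.
    + now apply geo_mean_peel_r.
    (* Here [m0 = S m] and the two lengths use different potentials: the geometric mean is bounded
       by the maximum, which is then peeled. *)
    + apply Rle_trans with (2 := hull_max_peel_r k theta l m x).
      now apply geo_mean_le_hull_max.
    + apply hull_max_peel_r.
  - intros l m x Hl Hm.
    apply Rle_trans with (Phi (S l) m x + wt k theta x l);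
      [|apply HCle; unfold Phi; specialize (Hwt x l);
        destruct (m0 <=? m)%nat; apply Rplus_le_le_0_compat; auto].
    unfold Phi; destruct (Nat.leb_spec m0 (S m)), (Nat.leb_spec m0 m); try lia.
    + now apply geo_mean_peel_l.
    + apply Rle_trans with (2 := hull_max_peel_l k theta l m x).
      now apply geo_mean_le_hull_max.
    + apply hull_max_peel_l.
  - intros l m x t Hl Hm Hlm Ht.
    assert (Hg : t <= geo_mean theta l m x).
    { destruct (finite_argmax (wt k theta x) l m Hm) as (p & Hp & Hmax).
      destruct (finite_argmax (fun i => - wt k theta x i) l m Hm) as (q & Hq & Hmin).
      apply Rle_trans with (wt k theta x q); [now apply Ht|].
      apply (geo_mean_bounds k theta Hth l m x p q); auto.
      intros i Hi; specialize (Hmax i Hi); specialize (Hmin i Hi); lra. }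
    unfold Phi; destruct (_ <=? _)%nat; [exact Hg|].
    apply Rle_trans with (1 := Hg); now apply geo_mean_le_hull_max.
Qed.

(** * Sum and total variation *)

Section Variation.

Variables (k : nat) (g : R).
Hypothesis hg : 0 <= g.

(** The variation includes the edges to the sites 0 and [k + 1], so a profile supported in [1..k]
    pays for its slopes at both ends. *)
Definition var_sum (z : nat -> R) : R :=
  Rsum z (seq 1 k) + g * Rsum (fun e => Rabs (z (S e) - z e)) (seq 0 (S k)).

Lemma var_sum_ext z w : (forall i, z i = w i) -> var_sum z = var_sum w.
Proof.
  intros H; unfold var_sum; f_equal; [|f_equal]; apply Rsum_ext_in; intros; rewrite !H; auto.
Qed.

Lemma var_sum_ge_Rsum z : Rsum z (seq 1 k) <= var_sum z.
Proof.
  unfold var_sum.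
  assert (0 <= g * Rsum (fun e => Rabs (z (S e) - z e)) (seq 0 (S k))); [|lra].
  apply Rmult_le_pos; [exact hg|]; apply Rsum_nonneg; intros; apply Rabs_pos.
Qed.

Lemma var_sum_nonneg z : (forall i, 0 <= z i) -> 0 <= var_sum z.
Proof.
  intros Hz; apply Rle_trans with (2 := var_sum_ge_Rsum z); apply Rsum_nonneg; auto.
Qed.

Lemma var_sum_plus_le z w : var_sum (fun i => z i + w i) <= var_sum z + var_sum w.
Proof.
  unfold var_sum; rewrite Rsum_plus.
  assert (H : Rsum (fun e => Rabs (z (S e) + w (S e) - (z e + w e))) (seq 0 (S k)) <=
              Rsum (fun e => Rabs (z (S e) - z e)) (seq 0 (S k))
              + Rsum (fun e => Rabs (w (S e) - w e)) (seq 0 (S k))).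
  { rewrite <- Rsum_plus; apply Rsum_le; intros e _.
    replace (z (S e) + w (S e) - (z e + w e)) with ((z (S e) - z e) + (w (S e) - w e)) by ring.
    apply Rabs_triang. }
  apply Rmult_le_compat_l with (r := g) in H; lra.
Qed.

(** Each slope is at most the sum of the two values at its ends, so a spike is counted at most twice
    in the variation. *)
Lemma var_sum_single p t :
  (1 <= p <= k)%nat -> 0 <= t ->
  var_sum (fun i => if (i =? p)%nat then t else 0) <= (1 + 2 * g) * t.
Proof.
  intros Hp Ht; set (w := fun i => if (i =? p)%nat then t else 0).
  assert (Hw : forall i, 0 <= w i) by (intros; unfold w; destruct (_ =? _)%nat; lra).
  assert (Hs : forall a n, (a <= p < a + n)%nat -> Rsum w (seq a n) = t).
  { intros a n Han; rewrite (Rsum_single w _ p).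
    - unfold w; now rewrite Nat.eqb_refl.
    - apply seq_NoDup.
    - apply in_seq; lia.
    - intros i _ Hi; unfold w; destruct (Nat.eqb_spec i p); [contradiction|reflexivity]. }
  assert (H : Rsum (fun e => Rabs (w (S e) - w e)) (seq 0 (S k)) <= t + t).
  { rewrite <- (Hs 1%nat (S k)) at 1 by lia; rewrite <- (Hs 0%nat (S k)) by lia.
    rewrite (Rsum_seq_shift w), <- Rsum_plus; apply Rsum_le; intros e _.
    specialize (Hw e) as H1; specialize (Hw (S e)) as H2.
    unfold Rabs; destruct Rcase_abs; lra. }
  unfold var_sum; rewrite Hs by lia.
  apply Rmult_le_compat_l with (r := g) in H; [lra|exact hg].
Qed.

Lemma var_sum_update z w j :
  (1 <= j <= k)%nat -> (forall i, i <> j -> w i = z i) ->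
  var_sum w - var_sum z =
  (w j - z j) + g * ((Rabs (w j - z (j - 1)%nat) - Rabs (z j - z (j - 1)%nat))
                     + (Rabs (z (S j) - w j) - Rabs (z (S j) - z j))).
Proof.
  intros Hj H.
  assert (E1 : Rsum (fun i => w i - z i) (seq 1 k) = w j - z j).
  { apply (Rsum_single (fun i => w i - z i)); [apply seq_NoDup|apply in_seq; lia|].
    intros i _ Hi; rewrite H by exact Hi; ring. }
  set (D := fun e => Rabs (w (S e) - w e) - Rabs (z (S e) - z e)).
  assert (E2 : Rsum D (seq 0 (S k)) = D (j - 1)%nat + D j).
  { replace (S k) with (j + S (k - j))%nat by lia; rewrite seq_app, Rsum_app.
    simpl (0 + j)%nat.
    rewrite (Rsum_single D _ (j - 1)%nat), (Rsum_single D (seq j _) j); auto;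
      try apply seq_NoDup; try (apply in_seq; lia);
      intros i Hi Hne; apply in_seq in Hi; unfold D; rewrite !H by lia; ring. }
  unfold D in E2.
  rewrite (Rsum_ext_in _ (fun i => w i + (-1) * z i)) in E1 by (intros; ring).
  rewrite (Rsum_ext_in _ (fun e => Rabs (w (S e) - w e) + (-1) * Rabs (z (S e) - z e))) in E2
    by (intros; ring).
  rewrite Rsum_plus, Rsum_scal in E1, E2.
  replace (S (j - 1)) with j in E2 by lia.
  rewrite (H (j - 1)%nat), (H (S j)) in E2 by lia.
  unfold var_sum.
  replace (Rsum w (seq 1 k)) with (w j - z j + Rsum z (seq 1 k)) by lra.
  rewrite <- (Rplus_comm (Rabs (z (S j) - w j) - Rabs (z (S j) - z j))).
  replace (Rsum (fun e => Rabs (w (S e) - w e)) (seq 0 (S k))) with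
    (Rsum (fun e => Rabs (z (S e) - z e)) (seq 0 (S k))
     + ((Rabs (w j - z (j - 1)%nat) - Rabs (z j - z (j - 1)%nat))
        + (Rabs (z (S j) - w j) - Rabs (z (S j) - z j)))) by lra.
  ring.
Qed.

End Variation.

(** * Drift of the sum and the variation *)

Section Nucleation.

Variables (k : nat) (b0 b1 b2 theta g : R).
Hypotheses (h0 : 0 < b0) (h02 : b0 < b2) (h21 : b2 < b1)
  (htheta : 0 < theta) (hexp : exp theta = 2) (hg : 0 <= g).

Local Notation y := (wt k theta).
Local Notation Y := (nbr k theta).
Local Notation r := (xrate k b0 b1 b2).

(** The cut-off keeps the weights of the neighbours out of [var_potential], which is therefore local
    to the interval. *)
Definition masked (l m : nat) (x : nat -> Z) (j : nat) : R :=
  if ((l <=? j) && (j <? l + m))%nat then y x j else 0.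

Lemma masked_in l m x j : (l <= j < l + m)%nat -> masked l m x j = y x j.
Proof.
  intros Hj; unfold masked; destruct (Nat.leb_spec l j), (Nat.ltb_spec j (l + m)); auto; lia.
Qed.

Lemma masked_out l m x j : ~ (l <= j < l + m)%nat -> masked l m x j = 0.
Proof.
  intros Hj; unfold masked; destruct (Nat.leb_spec l j), (Nat.ltb_spec j (l + m)); auto; lia.
Qed.

Lemma masked_nonneg l m x j : 0 <= masked l m x j.
Proof. unfold masked; destruct (_ && _); [apply wt_nonneg|lra]. Qed.

Lemma masked_bump_neq l m x i j : i <> j -> masked l m (bump x j) i = masked l m x i.
Proof. intros H; unfold masked; now rewrite wt_bump_neq. Qed.

Definition var_potential (l m : nat) (x : nat -> Z) : R := var_sum k g (masked l m x).

Lemma var_potential_local l m x j :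
  ~ (l <= j < l + m)%nat -> var_potential l m (bump x j) = var_potential l m x.
Proof.
  intros Hj; apply var_sum_ext; intros i.
  destruct (Nat.eq_dec i j) as [->|H]; [now rewrite !masked_out|now apply masked_bump_neq].
Qed.

Lemma var_potential_0 l x : var_potential l 0 x = 0.
Proof.
  unfold var_potential, var_sum.
  rewrite !Rsum_zero; [ring| |]; intros; rewrite !masked_out by lia; [|reflexivity].
  rewrite Rminus_0_r; apply Rabs_R0.
Qed.

Lemma var_potential_nonneg l m x : 0 <= var_potential l m x.
Proof. apply var_sum_nonneg; [exact hg|]; intros; apply masked_nonneg. Qed.

Lemma var_potential_ge l m x t :
  (1 <= l)%nat -> (1 <= m)%nat -> (l + m <= k + 1)%nat ->
  (forall j, (l <= j < l + m)%nat -> t <= y x j) -> t <= var_potential l m x.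
Proof.
  intros Hl Hm Hlm Ht; apply Rle_trans with (Rsum (masked l m x) (seq 1 k));
    [|apply var_sum_ge_Rsum, hg].
  apply Rle_trans with (masked l m x l); [rewrite masked_in by lia; apply Ht; lia|].
  apply Rsum_ge_term; [intros; apply masked_nonneg|apply in_seq; lia].
Qed.

Lemma var_potential_peel l m l' p x :
  (1 <= p <= k)%nat ->
  (forall j, masked l (S m) x j = masked l' m x j + (if (j =? p)%nat then y x p else 0)) ->
  var_potential l (S m) x <= var_potential l' m x + (1 + 2 * g) * y x p.
Proof.
  intros Hp H; unfold var_potential; rewrite (var_sum_ext _ _ _ _ H).
  apply Rle_trans with (1 := var_sum_plus_le k g hg _ _); apply Rplus_le_compat_l.
  apply var_sum_single; auto; apply wt_nonneg.
Qed.

Lemma var_potential_peel_r l m x :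
  (1 <= l)%nat -> (l + S m <= k + 1)%nat ->
  var_potential l (S m) x <= var_potential l m x + (1 + 2 * g) * y x (l + m).
Proof.
  intros Hl Hm; apply var_potential_peel; [lia|]; intros j; unfold masked.
  destruct (Nat.leb_spec l j), (Nat.ltb_spec j (l + S m)), (Nat.ltb_spec j (l + m)),
    (Nat.eqb_spec j (l + m)); try lia; subst; simpl; ring.
Qed.

Lemma var_potential_peel_l l m x :
  (1 <= l)%nat -> (l + S m <= k + 1)%nat ->
  var_potential l (S m) x <= var_potential (S l) m x + (1 + 2 * g) * y x l.
Proof.
  intros Hl Hm; apply var_potential_peel; [lia|]; intros j; unfold masked.
  destruct (Nat.leb_spec l j), (Nat.leb_spec (S l) j), (Nat.ltb_spec j (l + S m)),
    (Nat.ltb_spec j (S l + m)), (Nat.eqb_spec j l); try lia; subst; simpl; ring.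
Qed.

Definition climb (z : nat -> R) (j : nat) : R :=
  Rmax 0 (z (j - 1)%nat - z j) + Rmax 0 (z (S j) - z j).

Lemma climb_nonneg z j : 0 <= climb z j.
Proof. apply Rplus_le_le_0_compat; apply Rmax_l. Qed.

(** Each edge contributes its slope to [climb] at its lower end only. *)
Lemma Rsum_climb_le z :
  Rsum (climb z) (seq 1 k) <= Rsum (fun e => Rabs (z (S e) - z e)) (seq 0 (S k)).
Proof.
  unfold climb; rewrite Rsum_plus.
  rewrite (Rsum_seq_shift (fun j => Rmax 0 (z (j - 1)%nat - z j))).
  set (d := fun e => Rmax 0 (z e - z (S e))); set (u := fun e => Rmax 0 (z (S e) - z e)).
  assert (E : Rsum (fun i => Rmax 0 (z (S i - 1)%nat - z (S i))) (seq 0 k) = Rsum d (seq 0 k)).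
  { apply Rsum_ext_in; intros i _; unfold d; now replace (S i - 1)%nat with i by lia. }
  rewrite E; change (Rsum (fun j => Rmax 0 (z (S j) - z j)) (seq 1 k)) with (Rsum u (seq 1 k)).
  assert (Hd : Rsum d (seq 0 k) <= Rsum d (seq 0 (S k))).
  { rewrite Rsum_seq_S; assert (0 <= d (0 + k)%nat) by apply Rmax_l; lra. }
  assert (Hu : Rsum u (seq 1 k) <= Rsum u (seq 0 (S k))).
  { change (seq 0 (S k)) with (0%nat :: seq 1 k); rewrite Rsum_cons.
    assert (0 <= u 0%nat) by apply Rmax_l; lra. }
  apply Rle_trans with (Rsum d (seq 0 (S k)) + Rsum u (seq 0 (S k))); [lra|].
  rewrite <- Rsum_plus; apply Rsum_le; intros e _; unfold d, u, Rmax, Rabs.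
  repeat destruct Rle_dec; destruct Rcase_abs; lra.
Qed.

(** Doubling a value that is at most half of a neighbour shortens that edge by [z j] and lengthens
    the other by at most [z j], so the variation does not grow; the gain [z j] of the sum fits into
    the gap below that neighbour. *)
Lemma climb_at z j :
  z j < z (j - 1)%nat \/ z j < z (S j) ->
  (z j < z (j - 1)%nat -> 2 * z j <= z (j - 1)%nat) -> (z j < z (S j) -> 2 * z j <= z (S j)) ->
  0 <= z j ->
  z j + g * ((Rabs (2 * z j - z (j - 1)%nat) - Rabs (z j - z (j - 1)%nat))
             + (Rabs (z (S j) - 2 * z j) - Rabs (z (S j) - z j))) <= climb z j.
Proof.
  intros H Hl Hr Hz; unfold climb.
  assert (Hinc : (Rabs (2 * z j - z (j - 1)%nat) - Rabs (z j - z (j - 1)%nat))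
             + (Rabs (z (S j) - 2 * z j) - Rabs (z (S j) - z j)) <= 0).
  { destruct (Rlt_le_dec (z j) (z (j - 1)%nat)) as [H1|H1];
      destruct (Rlt_le_dec (z j) (z (S j))) as [H2|H2];
      try specialize (Hl H1); try specialize (Hr H2);
      unfold Rabs; repeat destruct Rcase_abs; lra. }
  assert (Hc : z j <= Rmax 0 (z (j - 1)%nat - z j) + Rmax 0 (z (S j) - z j)).
  { destruct H as [H|H]; [specialize (Hl H)|specialize (Hr H)];
      unfold Rmax; repeat destruct Rle_dec; lra. }
  assert (0 <= g * - ((Rabs (2 * z j - z (j - 1)%nat) - Rabs (z j - z (j - 1)%nat))
             + (Rabs (z (S j) - 2 * z j) - Rabs (z (S j) - z j)))) by (apply Rmult_le_pos; lra).
  lra.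
Qed.

(** The three terms match three kinds of jumps inside the interval: at a local maximum that also
    dominates the neighbours of the interval, at rate [b0]; below an adjacent site of the interval,
    at rate at most [b1]; and at a local maximum of the masked profile below [Y], whose gain [Y]
    absorbs. *)
Lemma var_potential_jump l m x j :
  (1 <= l)%nat -> (l + m <= k + 1)%nat -> (1 <= j <= k)%nat ->
  r x j * (var_potential l m (bump x j) - var_potential l m x) <=
  b0 * (1 + 2 * g) * masked l m x j + b1 * climb (masked l m x) j
  + b1 * (1 + 2 * g) * Y l m x.
Proof.
  intros Hl Hlm Hj.
  assert (Hr := xrate_pos k b0 b1 b2 h0 h02 h21 x j).
  assert (Hr1 := xrate_le k b0 b1 b2 h02 h21 x j).
  assert (Hm := masked_nonneg l m x).
  assert (Hc := climb_nonneg (masked l m x) j).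
  assert (HY : 0 <= Y l m x) by (apply Rle_trans with (2 := Rmax_l _ _), wt_nonneg).
  assert (H1 : 0 <= b0 * (1 + 2 * g) * masked l m x j) by (repeat apply Rmult_le_pos; auto; lra).
  assert (H2 : 0 <= b1 * climb (masked l m x) j) by (apply Rmult_le_pos; lra).
  assert (H3 : 0 <= b1 * (1 + 2 * g) * Y l m x) by (repeat apply Rmult_le_pos; lra).
  destruct (Nat.le_gt_cases l j) as [Hlj|Hlj];
    [destruct (Nat.le_gt_cases (l + m) j) as [Hjm|Hjm]|];
    try (rewrite var_potential_local by lia; lra).
  set (z := masked l m x) in *.
  assert (Hzj : z j = y x j) by (apply masked_in; lia).
  unfold var_potential; fold z.
  rewrite (var_sum_update k g z (masked l m (bump x j)) j) by
    (auto; intros; now apply masked_bump_neq).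
  replace (masked l m (bump x j) j) with (2 * z j)
    by (rewrite masked_in, wt_bump_eq, hexp, Hzj by lia; reflexivity).
  set (I := (Rabs (2 * z j - z (j - 1)%nat) - Rabs (z j - z (j - 1)%nat))
            + (Rabs (z (S j) - 2 * z j) - Rabs (z (S j) - z j))).
  assert (HI : I <= 2 * z j).
  { specialize (Hm j); fold z in Hm; unfold I, Rabs; repeat destruct Rcase_abs; lra. }
  assert (HgI : 2 * z j - z j + g * I <= (1 + 2 * g) * z j).
  { assert (g * I <= g * (2 * z j)) by (apply Rmult_le_compat_l; auto); lra. }
  (* A jump doubles the weight because [exp theta = 2], and by integrality it overtakes no higher
     weight. *)
  assert (Hstep : forall i, (l <= i < l + m)%nat -> z j < z i -> 2 * z j <= z i).
  { intros i Hi; unfold z; rewrite !masked_in by lia; rewrite <- hexp; apply wt_lt_step; auto. }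
  assert (Hstep' : forall i, z j < z i -> 2 * z j <= z i).
  { intros i Hi; destruct (Nat.le_gt_cases l i);
      [destruct (Nat.le_gt_cases (l + m) i)|]; try (apply Hstep; auto; lia);
      unfold z in Hi at 2; rewrite masked_out in Hi by lia; specialize (Hm j); fold z in Hm; lra. }
  destruct (Rlt_le_dec (z j) (z (j - 1)%nat)) as [Hzl|Hzl];
    [|destruct (Rlt_le_dec (z j) (z (S j))) as [Hzr|Hzr]].
  3: { destruct (Rlt_le_dec (y x j) (Y l m x)) as [HYj|HYj].
       - assert (r x j * (2 * z j - z j + g * I) <= r x j * ((1 + 2 * g) * z j))
           by (apply Rmult_le_compat_l; lra).
         assert (0 <= (1 + 2 * g) * z j) by (apply Rmult_le_pos; [lra|apply Hm]).
         assert (r x j * ((1 + 2 * g) * z j) <= b1 * ((1 + 2 * g) * Y l m x)).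
         { apply Rmult_le_compat; try lra; apply Rmult_le_compat_l; lra. }
         lra.
       - assert (Hrj : r x j = b0).
         { apply xrate_local_max with theta; auto.
           - destruct (Nat.eq_dec j l) as [->|].
             + apply Rle_trans with (2 := HYj), Rmax_l.
             + unfold z in Hzl; rewrite !masked_in in Hzl by lia; exact Hzl.
           - destruct (Nat.eq_dec (S j) (l + m)) as [E|].
             + rewrite E; apply Rle_trans with (2 := HYj), Rmax_r.
             + unfold z in Hzr; rewrite !masked_in in Hzr by lia; exact Hzr. }
         rewrite Hrj.
         assert (b0 * (2 * z j - z j + g * I) <= b0 * ((1 + 2 * g) * z j))
           by (apply Rmult_le_compat_l; lra).
         lra. }
  all: assert (Hcl : 2 * z j - z j + g * I <= climb z j) by
    (replace (2 * z j - z j) with (z j) by ring; apply climb_at; auto; apply Hm).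
  all: assert (r x j * (2 * z j - z j + g * I) <= r x j * climb z j)
    by (apply Rmult_le_compat_l; lra).
  all: assert (r x j * climb z j <= b1 * climb z j) by (apply Rmult_le_compat_r; lra).
  all: lra.
Qed.

(** The growth of local maxima is charged to the sum and lateral growth to the variation, whose
    coefficient is [g]; hence the two conditions on [lam]. *)
Lemma var_potential_drift l m x lam :
  (1 <= l)%nat -> (l + m <= k + 1)%nat ->
  b0 * (1 + 2 * g) <= lam -> b1 <= lam * g ->
  gen k b0 b1 b2 (var_potential l m) x <=
  lam * var_potential l m x + INR k * (b1 * (1 + 2 * g)) * Y l m x.
Proof.
  intros Hl Hlm H1 H2.
  apply Rle_trans with (Rsum (fun j => b0 * (1 + 2 * g) * masked l m x j
      + b1 * climb (masked l m x) j + b1 * (1 + 2 * g) * Y l m x) (seq 1 k)).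
  - apply Rsum_le; intros j Hj; apply in_seq in Hj; apply var_potential_jump; auto; lia.
  - rewrite !Rsum_plus, !Rsum_scal, Rsum_const, length_seq.
    assert (Hc := Rsum_climb_le (masked l m x)).
    unfold var_potential, var_sum.
    set (A := Rsum (masked l m x) (seq 1 k)).
    set (T := Rsum (fun e => Rabs (masked l m x (S e) - masked l m x e)) (seq 0 (S k))) in *.
    assert (HA : 0 <= A) by (apply Rsum_nonneg; intros; apply masked_nonneg).
    assert (HT : 0 <= T) by (apply Rsum_nonneg; intros; apply Rabs_pos).
    assert (b0 * (1 + 2 * g) * A <= lam * A) by (apply Rmult_le_compat_r; auto).
    assert (b1 * Rsum (climb (masked l m x)) (seq 1 k) <= b1 * T)
      by (apply Rmult_le_compat_l; lra).
    assert (b1 * T <= lam * g * T) by (apply Rmult_le_compat_r; auto).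
    lra.
Qed.

End Nucleation.

(** With [lam = b2 / 3] and [lam * g = b1], the remaining condition reads
    [b0 * b2 + 6 * (b1 * b0) <= b2 * b2 / 3]; as [b2 < b1], the factor 21 is enough. *)
Theorem ergodic_of_slow_nucleation (k : nat) (b0 b1 b2 : R) :
  (2 <= k)%nat -> 0 < b0 -> b0 < b2 -> b2 < b1 -> 21 * (b1 * b0) <= b2 * b2 ->
  shape_ergodic k b0 b1 b2.
Proof.
  intros hk h0 h02 h21 H.
  set (theta := ln 2).
  assert (Hth : 0 < theta) by (unfold theta; rewrite <- ln_1; apply ln_increasing; lra).
  assert (He : exp theta = 2) by (apply exp_ln; lra).
  (* The potential needs [b0 * (1 + 2 * g) <= lam] and [b1 <= lam * g] for some
     [lam < b2 / 2]; here [lam = b2 / 3]. *)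
  set (g := 3 * b1 / b2).
  assert (Hg : 0 < g) by (apply Rdiv_lt_0_compat; lra).
  assert (Hgb : b2 / 3 * g = b1) by (unfold g; field; lra).
  assert (Hb0 : b0 * (1 + 2 * g) <= b2 / 3).
  { apply Rmult_le_reg_r with b2; [lra|].
    replace (b0 * (1 + 2 * g) * b2) with (b0 * b2 + 6 * (b1 * b0)) by (unfold g; field; lra).
    nra. }
  set (C := (1 + 2 * g) * (1 + INR k * b1)).
  assert (Hk : 0 <= INR k * b1) by (apply Rmult_le_pos; [apply pos_INR|lra]).
  assert (HC : 1 + 2 * g <= C).
  { unfold C; rewrite <- (Rmult_1_r (1 + 2 * g)) at 1; apply Rmult_le_compat_l; lra. }
  assert (Hpeel : forall p t, 0 <= p -> 0 <= t -> p + (1 + 2 * g) * t <= C * (p + t)).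
  { intros p t Hp Ht.
    assert ((1 + 2 * g) * t <= C * t) by (apply Rmult_le_compat_r; lra).
    assert (1 * p <= C * p) by (apply Rmult_le_compat_r; lra); lra. }
  assert (Hnn : forall l m x, 0 <= var_potential k theta g l m x)
    by (intros; apply var_potential_nonneg; lra).
  assert (Hwt := wt_nonneg k theta).
  (* [1 - exp (- theta)] is one half, and [b2 / 6] is the margin between [b2 / 2] and [b2 / 3]. *)
  apply ergodic_of_interval_potential with theta (b2 / 6) C (var_potential k theta g);
    auto; try lra.
  - intros; apply var_potential_0.
  - intros; now apply var_potential_local.
  - intros l m x Hl Hm Hlm.
    assert (HY := nbr_pos k theta l m x Hl Hlm ltac:(lia)).
    apply Rle_trans with
      (1 := var_potential_drift k b0 b1 b2 theta g h0 h02 h21 Hth He (Rlt_le _ _ Hg)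
              l m x (b2 / 3) Hl Hlm Hb0 (Req_le _ _ (eq_sym Hgb))).
    rewrite exp_Ropp, He; apply Rplus_le_compat; apply Rmult_le_compat_r; auto; try lra.
    + unfold nbr_rate; destruct (_ =? _)%nat; lra.
    + unfold C; lra.
  - intros l m x Hl Hm.
    apply Rle_trans with (2 := Hpeel _ _ (Hnn _ _ _) (Hwt _ _)).
    apply var_potential_peel_r; auto; lra.
  - intros l m x Hl Hm.
    apply Rle_trans with (2 := Hpeel _ _ (Hnn _ _ _) (Hwt _ _)).
    apply var_potential_peel_l; auto; lra.
  - intros; apply var_potential_ge; auto; lra.
Qed.

(** * Verification of the conditions (a), (b) and (c) *)

Theorem theorem8 (b0 b1 b2 : R) (h0 : 0 < b0) (h1 : 0 < b1) (h2 : 0 < b2)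
    (h02 : b0 < b2) (h21 : b2 < b1) :
  (forall n : nat, (2 <= n)%nat ->
     (b2 > INR n * b0 \/ b2 > ((INR n - 1) * b1 + b0) / INR n) ->
     forall k : nat, (2 <= k)%nat -> (k <= n + 2)%nat -> shape_ergodic k b0 b1 b2)
  /\
  (b2 > 4 * sqrt 2 * sqrt (b1 * b0) ->
     forall k : nat, (2 <= k)%nat -> shape_ergodic k b0 b1 b2).
Proof.
  (* In this form the mean speed is seen to increase with the length. *)
  assert (Hmean : forall m, (1 <= m)%nat ->
            ((INR m - 1) * b1 + b0) / INR m = b1 - (b1 - b0) / INR m).
  { intros m Hm; field; apply not_0_INR; lia. }
  assert (Hedge : forall m, (1 <= m)%nat -> ((INR m - 1) * b1 + b0) / INR m < b1).
  { intros m Hm; rewrite Hmean by exact Hm.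
    assert (0 < (b1 - b0) / INR m) by (apply Rdiv_lt_0_compat; [lra|apply lt_0_INR; lia]); lra. }
  split.
  - intros n Hn [Ha|Hb] k Hk Hkn.
    (* Length [k - 1] uses the mean speed, which is below [b1]; the others satisfy
       [m <= k - 2 <= n], so [INR m * b0] is below [b2]. *)
    + apply ergodic_of_block_speed with (k - 1)%nat; auto; intros m Hm.
      unfold block_speed, nbr_rate.
      destruct (Nat.leb_spec (k - 1) m), (Nat.eqb_spec m (k - 1)); try lia.
      * apply Hedge; lia.
      * assert (INR m <= INR n) by (apply le_INR; lia).
        assert (INR m * b0 <= INR n * b0) by (apply Rmult_le_compat_r; lra); lra.
    (* Every length uses the mean speed; for [m <= k - 2 <= n] it is at most its value at [n], which
       is below [b2]. *)
    + apply ergodic_of_block_speed with 0%nat; auto; intros m Hm.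
      unfold block_speed, nbr_rate; simpl.
      destruct (Nat.eqb_spec m (k - 1)); [apply Hedge; lia|].
      rewrite Hmean in * by lia.
      assert ((b1 - b0) / INR n <= (b1 - b0) / INR m); [|lra].
      apply Rmult_le_compat_l; [lra|]; apply Rinv_le_contravar;
        [apply lt_0_INR; lia|apply le_INR; lia].
  - intros Hc k Hk; apply ergodic_of_slow_nucleation; auto.
    assert (Hp : 0 < b1 * b0) by now apply Rmult_lt_0_compat.
    assert (H2s := sqrt_sqrt 2 ltac:(lra)); assert (Hbs := sqrt_sqrt (b1 * b0) ltac:(lra)).
    assert (Hs : 0 <= 4 * sqrt 2 * sqrt (b1 * b0)).
    { generalize (sqrt_pos 2) (sqrt_pos (b1 * b0)); intros; repeat apply Rmult_le_pos; lra. }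
    (* Squaring (c) gives [32 * (b1 * b0) <= b2 * b2], more than the factor 21 asked for. *)
    assert (Hsq : (4 * sqrt 2 * sqrt (b1 * b0)) * (4 * sqrt 2 * sqrt (b1 * b0)) <= b2 * b2)
      by (apply Rmult_le_compat; lra).
    replace ((4 * sqrt 2 * sqrt (b1 * b0)) * (4 * sqrt 2 * sqrt (b1 * b0)))
      with (16 * (sqrt 2 * sqrt 2) * (sqrt (b1 * b0) * sqrt (b1 * b0))) in Hsq by ring.
    rewrite H2s, Hbs in Hsq; lra.
Qed.
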